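(* Let $a\in\mathbb{D}$, $a\neq 0$. Then $$\sigma\left(P_{N(C_a-I)}-P_{N(C_a+I)}\right)=[-1,-(1-|a|^2)^{1/2}]\cup[(1-|a|^2)^{1/2},1],$$ and the operator $P_{N(C_a-I)}-P_{N(C_a+I)}$ has no eigenvalues. In particular $$N(C_a-I)\cap N(C_a+I)^\perp=\{0\}=N(C_a-I)^\perp\cap N(C_a+I).$$
   Context: $\mathbb{D}=\{z\in\mathbb{C}:|z|<1\}$, $\mathbb{T}=\{z\in\mathbb{C}:|z|=1\}$, and $\mathcal{H}=L^2(\mathbb{T})$ with respect to normalized Lebesgue measure. For $a\in\mathbb{D}$, $\varphi_a(z)=\frac{a-z}{1-\bar a z}$ and $C_a:\mathcal{H}\to\mathcal{H}$ is the bounded composition operator $C_af=f\circ\varphi_a$ (so $C_a^2=I$). $N(T)$ denotes the nullspace of $T$, $P_{\mathcal{S}}$ the orthogonal projection onto a closed subspace $\mathcal{S}$, $\sigma$ the spectrum of an operator, and $\perp$ the orthogonal complement in $\mathcal{H}$. *)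

(* Defs.v *)
From HB Require Import structures.
From mathcomp Require Import all_boot all_order all_algebra.
From mathcomp Require Import generic_quotient.
From mathcomp Require Import all_classical all_reals all_analysis.
From mathcomp Require Import measurable_realfun complex.
From mathcomp Require Import ring lra.

Set Implicit Arguments.
Unset Strict Implicit.
Unset Printing Implicit Defensive.

Import Order.TTheory GRing.Theory Num.Theory.
Import numFieldNormedType.Exports.
Import ComplexField.Normc.

Local Notation Re := complex.Re.
Local Notation Im := complex.Im.

Local Open Scope classical_set_scope.
Local Open Scope complex_scope.
Local Open Scope quotient_scope.
Local Open Scope ring_scope.

Section L2fun.
Context d (T : measurableType d) (R : realType).
Variable mu : {measure set T -> \bar R}.

Definition square_integrable (f : T -> R[i]) : Prop :=
  [/\ measurable_fun setT (fun x => Re (f x)),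
      measurable_fun setT (fun x => Im (f x)) &
      (\int[mu]_x (normc (f x) ^+ 2)%:E < +oo)%E].

Definition L2pred : {pred T -> R[i]} := fun f => `[< square_integrable f >].

Lemma normc2E (z : R[i]) : normc z ^+ 2 = Re z ^+ 2 + Im z ^+ 2.
Proof. by case: z => a b /=; rewrite sqr_sqrtr// addr_ge0// sqr_ge0. Qed.

Lemma measurable_normc2 (f : T -> R[i]) :
  measurable_fun setT (fun x => Re (f x)) ->
  measurable_fun setT (fun x => Im (f x)) ->
  measurable_fun setT (fun x => (normc (f x) ^+ 2)%:E).
Proof.
move=> mr mi; apply/measurable_EFinP.
under eq_fun do rewrite normc2E.
by apply: measurable_funD; exact: measurable_funX.
Qed.

Lemma L2pred_submod_closed : submod_closed L2pred.
Proof.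
split.
  apply/asboolP; split => /=; [exact: measurable_cst|exact: measurable_cst|].
  by under eq_integral do rewrite expr0n/= addr0 sqrtr0 expr0n/=; rewrite integral0.
move=> c f g /asboolP[fr fi fl] /asboolP[gr gi gl].
have RM (z w : R[i]) : Re (z * w) = Re z * Re w - Im z * Im w.
  by case: z; case: w.
have IM (z w : R[i]) : Im (z * w) = Re z * Im w + Im z * Re w.
  by case: z; case: w.
have RD (z w : R[i]) : Re (z + w) = Re z + Re w by case: z; case: w.
have ID (z w : R[i]) : Im (z + w) = Im z + Im w by case: z; case: w.
have mr : measurable_fun setT (fun x => Re ((c *: f + g) x)).
  rewrite (_ : (fun _ => _) =
    (fun x => (Re c * Re (f x) - Im c * Im (f x)) + Re (g x))); last first.
    by apply/funext => x; rewrite /= RD RM.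
  apply: measurable_funD => //; apply: measurable_funB;
    by apply: measurable_funM => //; exact: measurable_cst.
have mi : measurable_fun setT (fun x => Im ((c *: f + g) x)).
  rewrite (_ : (fun _ => _) =
    (fun x => (Re c * Im (f x) + Im c * Re (f x)) + Im (g x))); last first.
    by apply/funext => x; rewrite /= ID IM.
  apply: measurable_funD => //; apply: measurable_funD;
    by apply: measurable_funM => //; exact: measurable_cst.
apply/asboolP; split => //.
pose k := 2 * normc c ^+ 2.
have k0 : 0 <= k by rewrite mulr_ge0// sqr_ge0.
apply: (@le_lt_trans _ _
    (\int[mu]_x (k%:E * (normc (f x) ^+ 2)%:E + 2%:E * (normc (g x) ^+ 2)%:E))%E).
  apply: ge0_le_integral => //.
  - by move=> x _; rewrite lee_fin sqr_ge0.
  - exact: measurable_normc2.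
  - by apply: emeasurable_funD; apply: measurable_funeM; exact: measurable_normc2.
  - move=> x _; rewrite -!EFinM -EFinD lee_fin /k !normc2E /= RD ID RM IM.
    set a := Re c; set b := Im c; set p := Re (f x); set q := Im (f x).
    set u := Re (g x); set v := Im (g x).
    have := sqr_ge0 (a * p - b * q - u); have := sqr_ge0 (a * q + b * p - v).
    nra.
rewrite ge0_integralD//; first last.
- by apply: measurable_funeM; exact: measurable_normc2.
- by move=> x _; rewrite -EFinM lee_fin mulr_ge0// sqr_ge0.
- by apply: measurable_funeM; exact: measurable_normc2.
- by move=> x _; rewrite -EFinM lee_fin mulr_ge0// sqr_ge0.
rewrite !ge0_integralZl//; first last.
- by move=> x _; rewrite lee_fin sqr_ge0.
- exact: measurable_normc2.
- by move=> x _; rewrite lee_fin sqr_ge0.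
- exact: measurable_normc2.
by apply: lte_add_pinfty; apply: lte_mul_pinfty; rewrite ?lee_fin.
Qed.

HB.instance Definition _ := GRing.isSubmodClosed.Build _ _ L2pred
  L2pred_submod_closed.

Record L2fun := L2Fun { L2fun_val :> T -> R[i]; _ : L2fun_val \in L2pred }.

HB.instance Definition _ := [isSub of L2fun for L2fun_val].
HB.instance Definition _ := [Choice of L2fun by <:].
HB.instance Definition _ := [SubChoice_isSubLmodule of L2fun by <:].

Definition L2eq (f g : L2fun) : bool := `[< {ae mu, forall x, f x = g x} >].

Lemma L2eq_refl : reflexive L2eq.
Proof. by move=> f; apply/asboolP; exact: aeW. Qed.

Lemma L2eq_sym : symmetric L2eq.
Proof.
by move=> f g; apply/idP/idP => /asboolP h; apply/asboolP; apply: filterS h.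
Qed.

Lemma L2eq_trans : transitive L2eq.
Proof.
move=> f g h /asboolP gf /asboolP fh; apply/asboolP.
by apply: filterS2 gf fh => x -> ->.
Qed.

Canonical L2eq_equiv := EquivRel L2eq L2eq_refl L2eq_sym L2eq_trans.

Definition L2 : Type := {eq_quot L2eq}.
HB.instance Definition _ := Choice.on L2.
HB.instance Definition _ := EqQuotient.on L2.

End L2fun.

Section L2lmod.
Context d (T : measurableType d) (R : realType).
Variable mu : {measure set T -> \bar R}.
Local Notation L2 := (L2 mu).
Implicit Types (f g : L2fun mu) (u v w : L2) (c : R[i]).

Lemma L2_eqP f g : reflect {ae mu, forall x, f x = g x} (\pi_L2 f == \pi_L2 g).
Proof. by rewrite eqmodE; exact: asboolP. Qed.

Lemma L2_reprP f : {ae mu, forall x, repr (\pi_L2 f) x = f x}.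
Proof. by apply/L2_eqP; rewrite reprK. Qed.

Definition L2zero : L2 := \pi_L2 0.
Definition L2opp u : L2 := \pi_L2 (- repr u).
Definition L2add u v : L2 := \pi_L2 (repr u + repr v).
Definition L2scale c u : L2 := \pi_L2 (c *: repr u).

Lemma L2opp_pi f : L2opp (\pi_L2 f) = \pi_L2 (- f).
Proof. by apply/eqP/L2_eqP; apply: filterS (L2_reprP f) => x fx; congr (- _). Qed.

Lemma L2add_pi f g : L2add (\pi_L2 f) (\pi_L2 g) = \pi_L2 (f + g).
Proof.
apply/eqP/L2_eqP.
by apply: filterS2 (L2_reprP f) (L2_reprP g) => x fx gx; congr (_ + _).
Qed.

Lemma L2scale_pi c f : L2scale c (\pi_L2 f) = \pi_L2 (c *: f).
Proof. by apply/eqP/L2_eqP; apply: filterS (L2_reprP f) => x fx; congr (_ * _). Qed.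

Lemma L2addA : associative L2add.
Proof.
elim/quotW=> f; elim/quotW=> g; elim/quotW=> h.
by rewrite (L2add_pi g h) (L2add_pi f g) (L2add_pi f) (L2add_pi _ h) addrA.
Qed.

Lemma L2addC : commutative L2add.
Proof.
by elim/quotW=> f; elim/quotW=> g; rewrite (L2add_pi f g) (L2add_pi g f) addrC.
Qed.

Lemma L2add0 : left_id L2zero L2add.
Proof. by elim/quotW=> f; rewrite (L2add_pi 0 f) add0r. Qed.

Lemma L2addN : left_inverse L2zero L2opp L2add.
Proof. by elim/quotW=> f; rewrite (L2opp_pi f) (L2add_pi _ f) addNr. Qed.

HB.instance Definition _ := GRing.isZmodule.Build L2 L2addA L2addC L2add0 L2addN.

Lemma L2scaleA c c' u : L2scale c (L2scale c' u) = L2scale (c * c') u.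
Proof.
elim/quotW: u => f.
by rewrite (L2scale_pi c' f) (L2scale_pi c) (L2scale_pi _ f) scalerA.
Qed.

Lemma L2scale1 : left_id 1 L2scale.
Proof. by elim/quotW=> f; rewrite (L2scale_pi 1 f) scale1r. Qed.

Lemma L2scaleDr : right_distributive L2scale +%R.
Proof.
move=> c; elim/quotW=> f; elim/quotW=> g.
rewrite [LHS](congr1 (L2scale c) (L2add_pi f g)).
by rewrite !L2scale_pi scalerDr -L2add_pi.
Qed.

Lemma L2scaleDl u : {morph L2scale^~ u : c c' / c + c'}.
Proof.
by elim/quotW: u => f c c'; rewrite !L2scale_pi scalerDl -L2add_pi.
Qed.

HB.instance Definition _ := GRing.Zmodule_isLmodule.Build R[i] L2
  L2scaleA L2scale1 L2scaleDr L2scaleDl.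

(* The class of [f]; it is [0] by convention when [f] is not square
   integrable. *)
Definition L2class (f : T -> R[i]) : L2 :=
  if insub f is Some g then \pi_L2 (g : L2fun mu) else 0.

Definition Cintegral (f : T -> R[i]) : R[i] :=
  (\int[mu]_x Re (f x)) +i* (\int[mu]_x Im (f x)).

Definition L2dot u v : R[i] := Cintegral (fun x => repr u x * (repr v x)^*).

Definition L2norm u : R := Num.sqrt (Re (L2dot u u)).

End L2lmod.

Section Operators.
Context d (T : measurableType d) (R : realType).
Variable mu : {measure set T -> \bar R}.
Local Notation H := (L2 mu).

Definition nullspace (A : H -> H) : set H := [set u | A u = 0].

Definition orthocomplement (S : set H) : set H :=
  [set u | forall v, S v -> L2dot u v = 0].

(* [orthoproj S u] is the only [v] in [S] with [u - v] orthogonal to [S]; such a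
   [v] exists for every [u] when [S] is a closed subspace. *)
Definition orthoproj (S : set H) (u : H) : H :=
  xget 0 [set v | S v /\ orthocomplement S (u - v)].

Definition bounded_operator (A : {linear H -> H}) : Prop :=
  exists M : R, forall u, L2norm (A u) <= M * L2norm u.

Definition operator_spectrum (A : H -> H) : set R[i] :=
  [set l | ~ exists B : {linear H -> H},
    [/\ bounded_operator B,
        cancel (fun u => A u - l *: u) B &
        cancel B (fun u => A u - l *: u)]].

Definition operator_eigenvalue (A : H -> H) (l : R[i]) : Prop :=
  exists2 u, u != 0 & A u = l *: u.

(* The representative is immaterial when preimages of null sets by [phi] are
   null, and the default value of [L2class] is not reached when [phi] is
   measurable and the image measure of [mu] has a bounded density; Moebius maps
   of the circle satisfy both. *)
Definition composition_operator (phi : T -> T) (u : H) : H :=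
  L2class mu (repr u \o phi).

End Operators.

Section Circle.
Variable R : realType.

Record circle := Circle { circle_val :> R[i]; _ : `|circle_val| == 1 }.

HB.instance Definition _ := [isSub of circle for circle_val].
HB.instance Definition _ := [Choice of circle by <:].

Lemma circle1_subproof : `|1 : R[i]| == 1.
Proof. by rewrite normr1. Qed.

HB.instance Definition _ := isPointed.Build circle (Circle circle1_subproof).

Definition circle_open : set (set circle) :=
  [set A | exists2 U : set R[i]^o, open U & A = circle_val @^-1` U].

Definition circle_display : measure_display.
Proof. by []. Qed.

HB.instance Definition _ := @isMeasurable.Build circle_display circle
  <<s circle_open >> (@sigma_algebra0 _ setT _) (@sigma_algebraC _ _)
  (@sigma_algebra_bigcup _ setT _).

Lemma cis_subproof (t : R) : `|cos t +i* sin t| == 1.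
Proof. by rewrite normc_def /= cos2Dsin2 sqrtr1. Qed.

(* exp(i t) *)
Definition cis (t : R) : circle := Circle (cis_subproof t).

Lemma continuous_cis : continuous (fun t : R => cos t +i* sin t : R[i]^o).
Proof.
move=> t; apply/cvgrPdist_lt => /= -[e e'] /=; rewrite ltcE/= => /andP[/eqP-> e0].
have e20 : 0 < e / 2 by rewrite divr_gt0.
have /cvgrPdist_lt/(_ _ e20) C := @continuous_cos R t.
have /cvgrPdist_lt/(_ _ e20) S := @continuous_sin R t.
near=> s.
have Cs : `|cos t - cos s| < e / 2 by near: s.
have Ss : `|sin t - sin s| < e / 2 by near: s.
have nE (a b : R) : normc (a +i* b) <= `|a| + `|b|.
  rewrite /= -[leRHS]ger0_norm ?addr_ge0// -sqrtr_sqr ler_wsqrtr// sqrrD.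
  by rewrite !real_normK ?num_real// addrAC lerDl mulrn_wge0// mulr_ge0.
rewrite [X in X < _](_ : _ = (normc ((cos t - cos s) +i* (sin t - sin s)))%:C)//.
rewrite ltcR (le_lt_trans (nE _ _))// (splitr e) ltrD//.
Unshelve. all: by end_near. Qed.

Lemma measurable_cis : measurable_fun setT (cis : measurableTypeR R -> circle).
Proof.
apply: (@measurability _ _ _ _ _ _ circle_open) => //.
move=> _ [_ [U oU ->] <-]; rewrite setTI.
apply: open_measurable; rewrite -comp_preimage.
by move: oU; apply: open_comp => t _; exact: continuous_cis.
Qed.

HB.instance Definition _ := isMeasurableFun.Build _ _ _ _
  (cis : measurableTypeR R -> circle) measurable_cis.

Lemma gt0_2pi : 0 < 2 * pi :> R.
Proof. by rewrite mulr_gt0// pi_gt0. Qed.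

(* Normalized Lebesgue measure on the circle: the image under [cis] of the
   uniform probability measure on [0, 2 pi]. *)
Definition circle_measure : probability circle R :=
  distribution (uniform_prob gt0_2pi) (cis : {mfun measurableTypeR R >-> circle}).

Definition mobius (a z : R[i]) : R[i] := (a - z) / (1 - a^* * z).

Lemma mobius_circle_subproof (a : R[i]) (a1 : `|a| < 1) (z : circle) :
  `|mobius a z| == 1.
Proof.
case: z => z /= /eqP z1.
have zz : z * z^* = 1 by rewrite -normCK z1 expr1n.
have dE : 1 - a^* * z = z * (z - a)^*.
  by rewrite rmorphB mulrBr zz [z * _]mulrC.
have d0 : `|1 - a^* * z| != 0.
  rewrite normr_eq0 subr_eq0; apply/negP => /eqP/(congr1 Num.norm).
  by rewrite normr1 normrM norm_conjC z1 mulr1 => a1'; rewrite -a1' ltxx in a1.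
rewrite /mobius normf_div; apply/eqP; rewrite -[RHS](divff d0); congr (_ / _).
by rewrite dE normrM z1 mul1r norm_conjC distrC.
Qed.

Definition mobius_circle (a : R[i]) (a1 : `|a| < 1) (z : circle) : circle :=
  Circle (mobius_circle_subproof a1 z).

Definition Cmobius (a : R[i]) (a1 : `|a| < 1) :
    L2 circle_measure -> L2 circle_measure :=
  composition_operator (mobius_circle a1).

End Circle.

(* Main.v *)
From HB Require Import structures.
Require Import Defs.
From mathcomp Require Import all_boot all_order all_algebra.
From mathcomp Require Import all_classical all_reals all_analysis.
From mathcomp Require Import measurable_realfun complex.
From mathcomp Require Import ring lra.

Set Implicit Arguments.
Unset Strict Implicit.
Unset Printing Implicit Defensive.

Import Order.TTheory GRing.Theory Num.Theory.
Import numFieldNormedType.Exports.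
Import ComplexField.Normc.

Local Notation Re := complex.Re.
Local Notation Im := complex.Im.

Local Open Scope classical_set_scope.
Local Open Scope complex_scope.
Local Open Scope ring_scope.

(** Let $\varphi=\varphi_a$ and let $P=|\varphi'|$ be the Poisson kernel of $a$ on
    the circle. The change of variables
    $\int (f\circ\varphi)\,P = \int f$ ([ge0_integral_mobius]) and the relation
    $P\circ\varphi = 1/P$ govern all computations with operators. It is
    convenient to replace $P$ by $\kappa = (P-1)/(P+1)$, a function with values
    in $[-|a|,|a|]$ for which $P\circ\varphi=1/P$ reads
    $\kappa\circ\varphi=-\kappa$ ([kappa_mobius]).

    The operators $u\mapsto b\,u + c\,(u\circ\varphi)$ with bounded weights $b$
    and $c$ are bounded and closed under composition, because $\varphi$ is an
    involution ([wsum_bound], [wcomp_comp]); every operator below is of this kind.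
    The orthogonal projection onto $\{u : u\circ\varphi=\pm u\}$ is
    $u\mapsto\frac12\big((1-\kappa)\,u \pm (1+\kappa)\,u\circ\varphi\big)$: its
    values have the required symmetry, and the difference with $u$ is orthogonal
    to the subspace because the integrand of the inner product is sent to its
    opposite by the change of variables ([symproj_orthogonal]). Therefore
    $$D = P_{N(C_a-I)}-P_{N(C_a+I)} : u\mapsto (1+\kappa)\,u\circ\varphi,
      \qquad D^2 = \hbox{multiplication by } 1-\kappa^2 .$$

    The rest is read off from $D^2$.
    - An eigenvector for $l$ would vanish where $1-\kappa^2\ne l^2$, which is
      almost everywhere: the level sets of $\kappa$ have at most two points
      ([kappa2_level_ae], [projdiff_no_eigenvalue]).
    - If $l^2$ is at positive distance from the range $[1-|a|^2,1]$ of
      $1-\kappa^2$, then $(D-l)^{-1}=(D+l)\,(1-\kappa^2-l^2)^{-1}$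
      ([projdiff_resolvent]).
    - If $l=x$ is real with $x^2$ in that range, let $g$ be the indicator function
      of $E=\{k_1<\kappa<k_2\}$, where $k_1\ge0$ and $\kappa^2$ is close to
      $1-x^2$ on $E$. Then $(D-x)(D+x)g=(1-\kappa^2-x^2)g$ is small compared with
      $g$, while $(D+x)g$ is not: $\varphi$ maps $E$ to a set disjoint from $E$,
      so $(D+x)g=xg$ on $E$. Hence $D-x$ is not bounded below
      ([projdiff_spectrum]).
    - A vector of $N(C_a-I)\cap N(C_a+I)^\perp$ or of
      $N(C_a-I)^\perp\cap N(C_a+I)$ satisfies $Du=u$ or $Du=-u$, hence is zero
      ([symspace_meets_orthocomplement]).

    The change of variables comes from an explicit lift to the line:
    $\varphi(e^{it})=e^{i\theta(t)}$ with $\theta'(t)=P(e^{it})$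
    ([cis_mobius_lift], [is_derive_mobius_lift]). *)

(** * Integration against the image of a measure with a density *)

Section density_image.
Local Open Scope ereal_scope.
Context d d' (T : measurableType d) (T' : measurableType d') (R : realType).
Variables (m : {measure set T -> \bar R}) (phi : T -> T') (g : T -> R).
Hypothesis mphi : measurable_fun setT phi.
Hypothesis mg : measurable_fun setT g.
Hypothesis g0 : forall x, (0 <= g x)%R.

(** The image under [phi] of the measure with density [g] with respect to [m]. *)
Definition density_image (B : set T') : \bar R :=
  \int[m]_(x in phi @^-1` B) (g x)%:E.

Let mpre B : measurable B -> measurable (phi @^-1` B).
Proof. by move=> mB; rewrite -[X in measurable X]setTI; exact: mphi. Qed.

Lemma density_image_set0 : density_image set0 = 0.
Proof. by rewrite /density_image preimage_set0 integral_set0. Qed.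

Lemma density_image_ge0 B : 0 <= density_image B.
Proof. by apply: integral_ge0 => x _; rewrite lee_fin. Qed.

Lemma density_image_sigma_additive : semi_sigma_additive density_image.
Proof.
move=> F mF tF mUF; rewrite /density_image preimage_bigcup; apply: cvg_toP.
  apply: ereal_nondecreasing_is_cvgn => i j ij.
  apply: lee_sum_nneg_natr => // k _ _.
  by apply: integral_ge0 => x _; rewrite lee_fin.
rewrite ge0_integral_bigcup//=.
- by move=> k; exact: mpre.
- apply/measurable_EFinP; exact: measurable_funTS.
- by move=> x _; rewrite lee_fin.
- apply/trivIsetP => i j _ _ ij; rewrite -preimage_setI.
  by move/trivIsetP : tF => /(_ i j Logic.I Logic.I ij) ->; rewrite preimage_set0.
Qed.

(** Stated as an existence result because the measure structure depends on the
    measurability of [phi] and on the hypotheses on [g]. *)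
Lemma density_image_measure :
  exists n : {measure set T' -> \bar R}, n = density_image :> (set T' -> \bar R).
Proof.
pose mixin := isMeasure.Build _ _ _ density_image density_image_set0
  density_image_ge0 density_image_sigma_additive.
pose n : {measure set T' -> \bar R} := HB.pack density_image mixin.
by exists n.
Qed.

Import HBNNSimple.

(** True for indicator functions by hypothesis, hence for simple functions, hence
    for nonnegative functions by monotone convergence. Only the values of
    [n] matter, so [n] can be Lebesgue measure itself. *)
Lemma ge0_integral_density_image (n : {measure set T' -> \bar R})
    (f : T' -> \bar R) :
  (forall B, measurable B -> n B = density_image B) ->
  measurable_fun setT f -> (forall y, 0 <= f y) ->
  \int[n]_y f y = \int[m]_x (f (phi x) * (g x)%:E).
Proof.
move=> nE mf f0; pose f_ := nnsfun_approx measurableT mf.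
have mgE D : measurable_fun D (EFin \o g).
  by apply/measurable_EFinP; exact: measurable_funTS.
transitivity (limn (fun k => \int[n]_y (f_ k y)%:E)).
  rewrite -monotone_convergence//.
  - apply: eq_integral => y _; apply/esym/cvg_lim => //.
    by apply: cvg_nnsfun_approx => //.
  - by move=> k; exact/measurable_EFinP/measurable_funP.
  - by move=> k y _; rewrite lee_fin.
  - by move=> y _ i j ij; rewrite lee_fin; exact/lefP/nd_nnsfun_approx.
transitivity (limn (fun k => \int[m]_x ((f_ k (phi x))%:E * (g x)%:E))); last first.
  rewrite -monotone_convergence//.
  - apply: eq_integral => x _; apply/cvg_lim => //.
    by apply: cvgeZr => //; exact: cvg_nnsfun_approx.
  - move=> k; apply: emeasurable_funM => //.
    apply/measurable_EFinP; exact: (measurableT_comp (measurable_funP (f_ k))).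
  - by move=> k x _; rewrite mule_ge0 ?lee_fin.
  - move=> x _ i j ij; rewrite lee_wpmul2r ?lee_fin//.
    exact/lefP/nd_nnsfun_approx.
congr (limn _); apply/funext => k.
under eq_integral do rewrite fimfunE -fsumEFin//.
rewrite ge0_integral_fsum//; last 2 first.
  - by move=> r; exact/measurable_EFinP/measurable_funM.
  - by move=> r y _; rewrite nnfun_muleindic_ge0.
transitivity (\sum_(r \in range (f_ k))
   \int[m]_x (((r * \1_(f_ k @^-1` [set r]) (phi x))%:E) * (g x)%:E)); last first.
  rewrite -ge0_integral_fsum//.
  - apply: eq_integral => x _.
    rewrite -ge0_mule_fsuml ?fsumEFin -?fimfunE// => r.
    by rewrite nnfun_muleindic_ge0.
  - move=> r; apply: emeasurable_funM => //; apply/measurable_EFinP.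
    apply: measurable_funM => //.
    by apply: (measurableT_comp _ mphi) => //; exact: measurable_indic.
  - by move=> r x _; rewrite mule_ge0// ?nnfun_muleindic_ge0// lee_fin.
apply: eq_fsbigr => r; rewrite inE => -[y _ yr].
have r0 : (0 <= r)%R by rewrite -yr.
rewrite integralZl_indic_nnsfun// integral_indic// setIT nE//.
rewrite /density_image integral_mkcond -ge0_integralZl//; first last.
- by move=> x _; rewrite patchE; case: ifP => _ //; rewrite lee_fin.
- by apply/(measurable_restrictT _ _).1 => //; exact: mpre.
apply: eq_integral => x _; rewrite patchE indicE -EFinM.
have -> : (x \in phi @^-1` (f_ k @^-1` [set r])) =
    (phi x \in f_ k @^-1` [set r]) by apply/idP/idP; rewrite !inE.
by case: ifP => _; rewrite ?mulr1// mulr0 mule0 mul0r.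
Qed.

End density_image.

(** * Substitution on the line for Borel functions *)

Section substitution.
Local Open Scope ereal_scope.
Context (R : realType).
Variables theta g : R -> R.
Hypothesis theta' : forall t, is_derive t (1%R : R) theta (g t).
Hypothesis cg : continuous g.
Hypothesis g_gt0 : forall t, (0 < g t)%R.
Hypothesis theta_surj : forall y, exists t, theta t = y.
Local Notation leb := (@lebesgue_measure R).

Lemma substitution_continuous : continuous theta.
Proof. by move=> t; apply: differentiable_continuous; apply/derivable1_diffP. Qed.

Lemma substitution_increasing : {mono theta : x y / (x <= y)%R}.
Proof.
apply: le_mono => x y xy.
apply: (@gtr0_derive1_lt_cc _ theta x y); rewrite ?in_itv/= ?lexx ?(ltW xy)//.
- by move=> t _; rewrite derive1E (@derive_val _ _ _ _ _ _ _ (theta' t)).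
- exact/continuous_subspaceT/substitution_continuous.
Qed.

(** The preimage of a half-open interval under the increasing bijection [theta] is
    the half-open interval of the preimages of its ends, over which the derivative
    [g] integrates to the original length. *)
Lemma substitution_ocitv B : ocitv B -> leb B = density_image leb theta g B.
Proof.
case=> -[u v] _ <- /=; rewrite /density_image.
have [x <-] := theta_surj u; have [y <-] := theta_surj v.
have -> : theta @^-1` `]theta x, theta y] = `]x, y]%classic.
  apply/seteqP; split => t /=; rewrite !in_itv/=;
  by rewrite !(leW_mono substitution_increasing) !substitution_increasing.
rewrite integral_itv_obnd_cbnd; last first.
  apply/measurable_funTS/measurable_EFinP.
  exact: continuous_measurable_fun.
rewrite lebesgue_measure_itv/= lte_fin (leW_mono substitution_increasing).
case: ltP => [xy|yx].
  rewrite (@continuous_FTC2 _ g theta)//.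
  - exact: continuous_subspaceT.
  - split.
    + by move=> t _; exact: (@ex_derive _ _ _ _ _ _ _ (theta' t)).
    + exact/cvg_at_right_filter/substitution_continuous.
    + exact/cvg_at_left_filter/substitution_continuous.
  - by move=> t _; rewrite derive1E (@derive_val _ _ _ _ _ _ _ (theta' t)).
move: yx; rewrite le_eqVlt => /predU1P[->|yx].
  by rewrite set_itv1 integral_set1.
by rewrite set_itv_ge ?integral_set0//= bnd_simp -ltNge.
Qed.

(** The image under [theta] of the measure with density [g] agrees with Lebesgue
    measure on half-open intervals, so the two measures are equal. *)
Lemma ge0_integral_substitution (f : R -> \bar R) :
  measurable_fun setT f -> (forall y, 0 <= f y) ->
  \int[leb]_y f y = \int[leb]_x (f (theta x) * (g x)%:E).
Proof.
move=> mf f0.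
have mtheta : measurable_fun setT (theta : R -> measurableTypeR R).
  by apply: continuous_measurable_fun; exact: substitution_continuous.
have mg : measurable_fun setT g by exact: continuous_measurable_fun.
have g0 t : (0 <= g t)%R by exact: ltW.
have [n nE] := density_image_measure leb mtheta mg g0.
apply: ge0_integral_density_image => // B mB.
rewrite -nE; apply: lebesgue_measure_unique => // X oX.
by rewrite nE substitution_ocitv.
Qed.

Lemma ge0_integral_substitution_itv (f : R -> \bar R) x y :
  measurable_fun setT f -> (forall y, 0 <= f y) ->
  \int[leb]_(t in `[theta x, theta y]) f t =
  \int[leb]_(t in `[x, y]) (f (theta t) * (g t)%:E).
Proof.
move=> mf f0; rewrite integral_mkcond ge0_integral_substitution; last 2 first.
- by apply/(measurable_restrictT _ _).1 => //; exact: measurable_funTS.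
- by move=> t; rewrite patchE; case: ifP.
rewrite [RHS]integral_mkcond; apply: eq_integral => t _; rewrite !patchE.
rewrite !mem_setE !in_itv/= !substitution_increasing.
by case: ifP => //; rewrite mul0e.
Qed.

End substitution.

(** * Moebius involutions and Poisson kernels *)

Section complex_parts.
Context (R : realType).
Implicit Types z w : R[i].

Lemma cReD z w : Re (z + w) = Re z + Re w. Proof. by case: z; case: w. Qed.
Lemma cImD z w : Im (z + w) = Im z + Im w. Proof. by case: z; case: w. Qed.
Lemma cReN z : Re (- z) = - Re z. Proof. by case: z. Qed.
Lemma cImN z : Im (- z) = - Im z. Proof. by case: z. Qed.
Lemma cReM z w : Re (z * w) = Re z * Re w - Im z * Im w.
Proof. by case: z; case: w. Qed.
Lemma cImM z w : Im (z * w) = Re z * Im w + Im z * Re w.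
Proof. by case: z; case: w. Qed.
Lemma Re_conj z : Re z^* = Re z. Proof. by case: z. Qed.
Lemma Im_conj z : Im z^* = - Im z. Proof. by case: z. Qed.
Lemma complex_ext z w : Re z = Re w -> Im z = Im w -> z = w.
Proof. by case: z => ? ?; case: w => ? ? /= -> ->. Qed.

Definition complex_partsE := (cReD, cImD, cReN, cImN, cReM, cImM, Re_conj, Im_conj).

End complex_parts.

Section mobius_facts.
Context (R : realType) (a : R[i]) (a1 : `|a| < 1).
Implicit Types z : circle R.

Let rho2 : R := normc a ^+ 2.

Lemma circle_norm2 z : Re z ^+ 2 + Im z ^+ 2 = 1.
Proof.
case: z => z /= /eqP; rewrite normc_def => -[/(congr1 (fun x => x ^+ 2))].
by rewrite sqr_sqrtr ?addr_ge0 ?sqr_ge0// expr1n.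
Qed.

Lemma normc_nonneg (z : R[i]) : 0 <= normc z.
Proof. by case: z => x y /=; exact: sqrtr_ge0. Qed.

Lemma normc_lt1 : normc a < 1.
Proof. by move: a1; rewrite [X in X < _](_ : _ = (normc a)%:C)// (ltcR _ 1). Qed.

Lemma rho2_lt1 : rho2 < 1.
Proof. by rewrite expr_lt1// ?normc_lt1// normc_nonneg. Qed.

(** The real part of $\bar a z$, the scalar product of $a$ and $z$. *)
Definition rdot z : R := Re a * Re z + Im a * Im z.

Lemma rdot_le z : `|rdot z| <= normc a.
Proof.
rewrite -(ler_pXn2r (n := 2))// ?nnegrE ?normr_ge0 ?normc_nonneg//.
rewrite real_normK ?num_real// normc2E -[leRHS]mulr1 -(circle_norm2 z) /rdot.
by have := sqr_ge0 (Re a * Im z - Im a * Re z); lra.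
Qed.

Lemma rdot_lt1 z : rdot z < 1.
Proof. by rewrite (le_lt_trans _ normc_lt1)// (le_trans (ler_norm _))// rdot_le. Qed.

Lemma rdot_bounds z : - normc a <= rdot z <= normc a.
Proof. by rewrite -ler_norml rdot_le. Qed.

Lemma denom_gt0 z : 0 < 1 + rho2 - 2 * rdot z.
Proof.
have /andP[_] := rdot_bounds z; have := normc_lt1; have := normc_nonneg a.
rewrite /rho2; move: (normc a) (rdot z) => r x; nra.
Qed.

Lemma mobius_denom_neq0 z : 1 - a^* * z != 0.
Proof.
apply/negP => /eqP /(congr1 (@complex.Re R)); rewrite !complex_partsE/= => h.
have := rdot_lt1 z; rewrite /rdot; lra.
Qed.

(** This is $(P-1)/(P+1)$, where $P$ is the Poisson kernel [poisson]; see
    [poissonE]. *)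
Definition kappa z : R := (rdot z - rho2) / (1 - rdot z).

(** The denominator is $|1-\bar a z|^2$ on the circle. *)
Definition poisson z : R := (1 - rho2) / (1 + rho2 - 2 * rdot z).

(** For $x$ in $[-|a|,|a|]$ the function $(x-|a|^2)/(1-x)$ is increasing and takes
    the values $-|a|$ and $|a|$ at the ends. *)
Lemma kappa_bounds z : - normc a <= kappa z <= normc a.
Proof.
have /andP[x1 x2] := rdot_bounds z; have := normc_lt1; have := normc_nonneg a.
have := rdot_lt1 z; rewrite /kappa.
rewrite ler_pdivlMr ?subr_gt0 ?rdot_lt1// ler_pdivrMr ?subr_gt0 ?rdot_lt1//.
rewrite /rho2; move: (normc a) (rdot z) x1 x2 => r x; nra.
Qed.

Lemma kappa_lt1 z : -1 < kappa z < 1.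
Proof. by have := kappa_bounds z; have := normc_lt1; lra. Qed.

Lemma poissonE z : poisson z = (1 + kappa z) / (1 - kappa z).
Proof.
have := denom_gt0 z; have := rdot_lt1 z; have := kappa_lt1 z.
rewrite /poisson /kappa.
move: (rdot z) => x h1 h2 h3; field; lra.
Qed.

Lemma poisson_gt0 z : 0 < poisson z.
Proof. by rewrite divr_gt0 ?denom_gt0// subr_gt0 rho2_lt1. Qed.

(** Real and imaginary parts of $(1-\bar a z)\,\varphi_a(z) = a - z$, solved for
    $\varphi_a(z)$. *)
Lemma mobius_parts z :
  let N := 1 + rho2 - 2 * rdot z in
  let q := Re a * Im z - Im a * Re z in
  Re (mobius a z) = ((1 - rdot z) * (Re a - Re z) - q * (Im a - Im z)) / N /\
  Im (mobius a z) = ((1 - rdot z) * (Im a - Im z) + q * (Re a - Re z)) / N.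
Proof.
have N0 := denom_gt0 z.
have /(congr1 (fun w => (Re w, Im w))) : (1 - a^* * z) * mobius a z = a - (z : R[i]).
  by rewrite /mobius mulrC divfK// mobius_denom_neq0.
move: (mobius a z) => w /=; rewrite !complex_partsE/= => -[e1 e2].
have z1 := circle_norm2 z.
have NE : 1 + rho2 - 2 * rdot z =
    (1 - rdot z) ^+ 2 + (Re a * Im z - Im a * Re z) ^+ 2.
  rewrite /rho2 normc2E /rdot.
  have -> : Re a ^+ 2 + Im a ^+ 2 =
    (Re a ^+ 2 + Im a ^+ 2) * (Re z ^+ 2 + Im z ^+ 2) by rewrite z1 mulr1.
  ring.
split; apply: (canRL (mulfK (lt0r_neq0 N0))); rewrite NE -e1 -e2 /rdot; ring.
Qed.

Lemma rdot_mobius z :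
  rdot (mobius_circle a1 z) =
  (2 * rho2 - rdot z * (1 + rho2)) / (1 + rho2 - 2 * rdot z).
Proof.
have N0 := denom_gt0 z; have [h1 h2] := mobius_parts z.
have z1 := circle_norm2 z.
rewrite {1}/rdot/= h1 h2 (mulrA (Re a)) (mulrA (Im a)) -mulrDl; congr (_ / _).
rewrite /rho2 normc2E /rdot.
have : (Re a ^+ 2 + Im a ^+ 2) * (Re z ^+ 2 + Im z ^+ 2 - 1) = 0.
  by rewrite z1 subrr mulr0.
lra.
Qed.

Lemma kappa_mobius z : kappa (mobius_circle a1 z) = - kappa z.
Proof.
rewrite /kappa rdot_mobius.
have := denom_gt0 z; have := rdot_lt1 z; have := rho2_lt1.
move: (rdot z) (rho2) => x r h1 h2 h3; field.
repeat (apply/andP; split); rewrite ?gt_eqF//; nra.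
Qed.

Lemma mobius_circleK : involutive (mobius_circle a1).
Proof.
move=> z; apply/val_inj => /=; rewrite /mobius.
have d0 := mobius_denom_neq0 z; set w : R[i] := z.
rewrite -/w in d0 *.
have n0 : 1 - a^* * a != 0.
  apply/negP => /eqP /(congr1 (@complex.Re R)); rewrite !complex_partsE/= => h.
  by have := rho2_lt1; rewrite /rho2 normc2E; lra.
have n1 : 1 - a^* * w - a^* * (a - w) != 0.
  by rewrite [X in X != 0](_ : _ = 1 - a^* * a)//; ring.
by field; apply/andP; split.
Qed.

End mobius_facts.

(** * Measurability on the circle *)

Section homographic.
Context (K : numFieldType) (a b : K).

Lemma cvg_denom (z : K) : 1 - b * w @[w --> z] --> 1 - b * z.
Proof.
have FF : Filter (nbhs z) by exact: nbhs_filter.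
have c1 : (fun _ : K => 1 : K) @ z --> (1 : K) by exact: cvg_cst.
have cb : (fun w => b * w) @ z --> b * z.
  by apply: cvgM; [exact: cvg_cst|exact: cvg_id].
exact: cvgB c1 cb.
Qed.

Lemma cvg_homographic (z : K) : 1 - b * z != 0 ->
  (a - w) / (1 - b * w) @[w --> z] --> (a - z) / (1 - b * z).
Proof.
move=> z0; have FF : Filter (nbhs z) by exact: nbhs_filter.
have ca : (fun _ : K => a) @ z --> a by exact: cvg_cst.
have caz : (fun w => a - w) @ z --> a - z by exact: cvgB ca cvg_id.
exact: cvgM caz (cvgV z0 (@cvg_denom z)).
Qed.

Lemma near_denom_neq0 (z : K) : 1 - b * z != 0 ->
  \forall w \near z, 1 - b * w != 0.
Proof. by move=> z0; exact: (cvgr_neq0 _ (@cvg_denom z) z0). Qed.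

End homographic.

Section circle_measurability.
Context (R : realType).

Lemma continuous_Re : continuous (fun z : R[i]^o => Re z : R).
Proof.
move=> z; apply/(@cvgrPdist_lt _ _ _ (nbhs z) (nbhs_filter z)) => e e0.
exists e%:C; first by rewrite /= (ltcR 0).
move=> w; rewrite /ball_/=.
rewrite [X in X < _ -> _](_ : _ = (normc (z - w))%:C)// ltcR.
apply: le_lt_trans; rewrite -cReN -cReD -(ler_pXn2r (n := 2))// ?nnegrE ?normc_nonneg//.
by rewrite real_normK ?num_real// normc2E lerDl sqr_ge0.
Qed.

Lemma continuous_Im : continuous (fun z : R[i]^o => Im z : R).
Proof.
move=> z; apply/(@cvgrPdist_lt _ _ _ (nbhs z) (nbhs_filter z)) => e e0.
exists e%:C; first by rewrite /= (ltcR 0).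
move=> w; rewrite /ball_/=.
rewrite [X in X < _ -> _](_ : _ = (normc (z - w))%:C)// ltcR.
apply: le_lt_trans; rewrite -cImN -cImD -(ler_pXn2r (n := 2))// ?nnegrE ?normc_nonneg//.
by rewrite real_normK ?num_real// normc2E lerDr sqr_ge0.
Qed.

(** Preimages of open intervals are traces on the circle of open subsets of the
    plane. *)
Lemma measurable_circle_fun (f : R[i]^o -> R) : continuous f ->
  measurable_fun setT (fun z : circle R => f z).
Proof.
move=> cf; apply: (measurability _ (RGenOpens.measurableE R)).
move=> _ [_ [x [y ->]] <-]; rewrite setTI; apply: sub_sigma_algebra.
exists (f @^-1` `]x, y[) => //.
by move/continuousP : cf; apply; exact: interval_open.
Qed.

Lemma measurable_circle_Re : measurable_fun setT (fun z : circle R => Re z).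
Proof. exact: (measurable_circle_fun continuous_Re). Qed.

Lemma measurable_circle_Im : measurable_fun setT (fun z : circle R => Im z).
Proof. exact: (measurable_circle_fun continuous_Im). Qed.

Lemma measurable_fun_inv : measurable_fun setT (@GRing.inv R).
Proof.
have -> : [set: R] = [set 0] `|` ~` [set 0] by rewrite setUv.
apply/measurable_funU; [exact: measurable_set1|by apply: measurableC; exact: measurable_set1|].
split; first exact: measurable_fun_set1.
have -> : ~` [set 0 : R] = [set x | x != 0].
  by apply/seteqP; split => x /= /eqP.
apply: open_continuous_measurable_fun; first exact: open_neq.
by move=> x /set_mem /= x0; exact: inv_continuous.
Qed.

Lemma measurable_fun_div d (T : measurableType d) (f g : T -> R) :
  measurable_fun setT f -> measurable_fun setT g ->
  measurable_fun setT (fun x => f x / g x).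
Proof.
move=> mf mg; apply: measurable_funM => //.
exact: (measurableT_comp measurable_fun_inv).
Qed.

Context (a : R[i]) (a1 : `|a| < 1).

Lemma measurable_rdot : measurable_fun setT (@rdot R a).
Proof.
apply: measurable_funD; apply: measurable_funM => //.
  exact: measurable_circle_Re.
exact: measurable_circle_Im.
Qed.

Lemma measurable_kappa : measurable_fun setT (@kappa R a).
Proof.
have mr := measurable_rdot.
by apply: measurable_fun_div; apply: measurable_funB.
Qed.

Lemma measurable_poisson : measurable_fun setT (@poisson R a).
Proof.
have mr := measurable_rdot.
by apply: measurable_fun_div => //; apply: measurable_funB => //; exact: measurable_funM.
Qed.

(** The map is continuous only off its pole; the pole is not on the circle, so the
    preimage of an open set is the trace of an open set avoiding the pole. *)
Lemma measurable_mobius_circle : measurable_fun setT (mobius_circle a1).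
Proof.
apply: (@measurability _ _ _ _ _ _ (@circle_open R)) => //.
move=> _ [_ [U oU ->] <-]; rewrite setTI; apply: sub_sigma_algebra.
exists [set z : R[i]^o | 1 - a^* * z != 0 /\ U (mobius a z)]; last first.
  apply/seteqP; split => z /=; last by case.
  by move=> ?; split => //; exact: mobius_denom_neq0.
rewrite openE => z [z0 Uz]; rewrite /interior /=.
apply: filterI; first exact: (@near_denom_neq0 R[i]).
move: oU; rewrite openE => /(_ _ Uz).
exact: (@cvg_homographic R[i] a a^* z z0).
Qed.

End circle_measurability.

(** * The change of variables on the circle *)

Section angular_lift.
Context (R : realType) (a : R[i]) (a1 : `|a| < 1).

Let X (t : R) : R := 1 - (Re a * cos t + Im a * sin t).
Let Y (t : R) : R := Im a * cos t - Re a * sin t.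

(** Since $a - z = -z\,\bar u$ with $u = 1-\bar a z$ for $z$ on the circle,
    $\varphi_a(z) = -z\,\bar u/u$, whose argument is $\pi + t - 2\arg u$ at
    $z=e^{it}$. As $u = X + iY$ has positive real part, $\arg u$ is
    $\arctan(Y/X)$ for all $t$. *)
Definition mobius_lift (t : R) : R := pi + t - 2 * atan (Y t / X t).

Lemma X_rdot t : X t = 1 - rdot a (cis t). Proof. by []. Qed.

Let X_gt0 t : 0 < X t. Proof. by rewrite subr_gt0; exact: (rdot_lt1 a1 (cis t)). Qed.

Let XY2 t : X t ^+ 2 + Y t ^+ 2 = 1 + normc a ^+ 2 - 2 * rdot a (cis t).
Proof.
have := circle_norm2 (cis t) => /= cs.
have : (Re a ^+ 2 + Im a ^+ 2) * (cos t ^+ 2 + sin t ^+ 2 - 1) = 0.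
  by rewrite cs subrr mulr0.
by rewrite normc2E /X /Y /rdot/=; lra.
Qed.

Let X' (t : R) : is_derive t 1 X (- Y t).
Proof. by apply: is_derive_eq; rewrite /GRing.scale/= /Y; ring. Qed.

Let Y' (t : R) : is_derive t 1 Y (X t - 1).
Proof. by apply: is_derive_eq; rewrite /GRing.scale/= /X; ring. Qed.

Lemma is_derive_mobius_lift (t : R) : is_derive t 1 mobius_lift (poisson a (cis t)).
Proof.
have X0 := X_gt0 t; have hX := X' t; have hY := Y' t.
have hV : is_derive t 1 (fun t => (X t)^-1) (- (X t) ^- 2 *: - Y t).
  by apply: is_deriveV; rewrite gt_eqF.
have hQ : is_derive t 1 (fun t => Y t / X t)
    (((X t - 1) * X t + Y t ^+ 2) / X t ^+ 2).
  by apply: is_derive_eq; rewrite /GRing.scale/=; field; rewrite gt_eqF.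
have hA : is_derive t 1 (atan \o (fun t => Y t / X t))
    ((((X t - 1) * X t + Y t ^+ 2) / X t ^+ 2) * (1 + (Y t / X t) ^+ 2)^-1).
  by apply: is_derive_eq; rewrite mulrC.
apply: is_derive_eq; rewrite /GRing.scale/=.
have NE := XY2 t; have N0 := denom_gt0 a1 (cis t); rewrite -NE in N0.
have -> : poisson a (cis t) = (2 * X t - (X t ^+ 2 + Y t ^+ 2)) /
    (X t ^+ 2 + Y t ^+ 2).
  by rewrite /poisson -NE; congr (_ / _); rewrite NE X_rdot; ring.
by field; rewrite !gt_eqF//= addrC.
Qed.

Lemma continuous_poisson_cis : continuous (fun t => poisson a (cis t)).
Proof.
have -> : (fun t => poisson a (cis t)) =
    (fun t => (1 - normc a ^+ 2) * (X t * X t + Y t * Y t)^-1).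
  by apply/funext => s; rewrite -!expr2 XY2.
move=> t.
have cX : {for t, continuous X}.
  by apply: differentiable_continuous; apply/derivable1_diffP; case: (X' t).
have cY : {for t, continuous Y}.
  by apply: differentiable_continuous; apply/derivable1_diffP; case: (Y' t).
have N0 : X t * X t + Y t * Y t != 0.
  by rewrite -!expr2 XY2 gt_eqF// (denom_gt0 a1).
have c2 := continuousD (continuousM cX cX) (continuousM cY cY).
have c0 : {for t, continuous (fun=> 1 - normc a ^+ 2 : R)} by exact: cvg_cst.
exact: (continuousM c0 (@continuousV _ _ (X \* X + Y \* Y) t N0 c2)).
Qed.

Lemma mobius_lift_bounds t : t < mobius_lift t < t + 2 * pi.
Proof.
have := atan_gtNpi2 (Y t / X t); have := atan_ltpi2 (Y t / X t).
rewrite /mobius_lift; lra.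
Qed.

Lemma mobius_lift_surj y : exists t, mobius_lift t = y.
Proof.
have h1 := mobius_lift_bounds (y - 2 * pi); have h2 := mobius_lift_bounds y.
have p0 := @pi_gt0 R.
(* $t<\theta(t)<t+2\pi$ puts [y] between the values at $y-2\pi$ and [y]. *)
have [| | |t _ <-] := @IVT R mobius_lift (y - 2 * pi) y y; last by exists t.
- lra.
- apply: continuous_subspaceT => t; apply: differentiable_continuous.
  by apply/derivable1_diffP; case: (is_derive_mobius_lift t).
- by rewrite ge_min le_max; apply/andP; split; apply/orP; [left|right]; lra.
Qed.

Lemma mobius_lift_shift t : mobius_lift (t + 2 * pi) = mobius_lift t + 2 * pi.
Proof. by rewrite /mobius_lift /X /Y mulr_natl cosD2pi sinD2pi; ring. Qed.

Lemma cis_mobius_lift t : cis (mobius_lift t) = mobius_circle a1 (cis t).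
Proof.
have [mr mi] := mobius_parts a1 (cis t).
have X0 := X_gt0 t; have NE := XY2 t; have N0 := denom_gt0 a1 (cis t).
rewrite -NE in N0 mr mi.
set A := atan (Y t / X t).
have cA : 0 < cos A.
  by apply: cos_gt0_pihalf; rewrite atan_gtNpi2 atan_ltpi2.
have sX : sin A * X t = cos A * Y t.
  have := atanK (Y t / X t); rewrite -/A /tan.
  move=> /(canRL (divfK _)) -> //; last by rewrite gt_eqF.
  by field; rewrite gt_eqF.
have cs1 := cos2Dsin2 A.
have c2E : cos A ^+ 2 = X t ^+ 2 / (X t ^+ 2 + Y t ^+ 2).
  apply: (canRL (mulfK (lt0r_neq0 N0))).
  by rewrite mulrDr -[cos A ^+ 2 * Y t ^+ 2]exprMn -sX exprMn -mulrDl cs1 mul1r.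
have csE : cos A * sin A = X t * Y t / (X t ^+ 2 + Y t ^+ 2).
  have -> : sin A = cos A * Y t / X t by rewrite -sX mulfK// gt_eqF.
  rewrite !mulrA -expr2 c2E; field.
  by rewrite !gt_eqF.
have liftE : mobius_lift t = t - A *+ 2 + pi by rewrite /mobius_lift -/A; ring.
have ab : Re a - cos t = - (cos t * X t + sin t * Y t) /\
          Im a - sin t = - (sin t * X t - cos t * Y t).
  have e x : x * (cos t ^+ 2 + sin t ^+ 2) = x by rewrite cos2Dsin2 mulr1.
  by rewrite /X /Y; have := e (Re a); have := e (Im a); split; lra.
apply/val_inj/complex_ext => /=; rewrite liftE ?cosDpi ?sinDpi ?cosB ?sinB
  cos_mulr2n sin_mulr2n c2E csE ?mr ?mi -?X_rdot/= ab.1 ab.2.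
- have -> : Re a * sin t - Im a * cos t = - Y t by rewrite /Y; ring.
  by field; rewrite gt_eqF.
- have -> : Re a * sin t - Im a * cos t = - Y t by rewrite /Y; ring.
  by field; rewrite gt_eqF.
Qed.

End angular_lift.

Section circle_integral.
Local Open Scope ereal_scope.
Context (R : realType) (a : R[i]) (a1 : (`|a| < 1)%R).
Local Notation leb := (@lebesgue_measure R).
Local Notation mu := (circle_measure R).

Lemma cis_2pi (t : R) : cis (t + 2 * pi)%R = cis t.
Proof.
by apply/val_inj/complex_ext => /=; rewrite mulr_natl ?cosD2pi ?sinD2pi.
Qed.

Lemma measurable_comp_cis (f : circle R -> \bar R) : measurable_fun setT f ->
  measurable_fun setT (fun t : R => f (cis t)).
Proof. by move=> mf; exact: (measurableT_comp mf (@measurable_cis R)). Qed.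

Lemma ge0_integral_circle (f : circle R -> \bar R) :
  measurable_fun setT f -> (forall z, 0 <= f z) ->
  \int[mu]_z f z = (2 * pi)^-1%:E * \int[leb]_(t in `[0%R, (2 * pi)%R]) f (cis t).
Proof.
move=> mf f0; rewrite ge0_integral_distribution//.
by rewrite integral_uniform//= ?subr0//; exact: measurable_comp_cis.
Qed.

(** The part of the integral over $[2\pi, c+2\pi]$ is moved to $[0,c]$ by the
    substitution $t\mapsto t+2\pi$, which does not change $e^{it}$. *)
Lemma integral_cis_shift (f : circle R -> \bar R) (c : R) :
  measurable_fun setT f -> (forall z, 0 <= f z) -> (0 <= c <= 2 * pi)%R ->
  \int[leb]_(t in `[c, (c + 2 * pi)%R]) f (cis t) =
  \int[leb]_(t in `[0%R, (2 * pi)%R]) f (cis t).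
Proof.
move=> mf f0 /andP[c0 c2]; have mfc := measurable_comp_cis mf.
have split_itv (x y z : R) : (x <= y)%R -> (y <= z)%R ->
    \int[leb]_(t in `[x, z]) f (cis t) =
    \int[leb]_(t in `[x, y]) f (cis t) + \int[leb]_(t in `[y, z]) f (cis t).
  move=> xy yz; rewrite -(integral_itv_obnd_cbnd (r := y)); last exact: measurable_funTS.
  rewrite -ge0_integral_setU//=.
  - by rewrite -itv_bndbnd_setU// bnd_simp.
  - exact: measurable_funTS.
  - apply/disj_setPRL => t /=; rewrite !in_itv/= => /andP[yt _].
    by apply/negP; rewrite (leNgt t) yt andbF.
rewrite (split_itv c (2 * pi)%R)//; last by rewrite lerDr.
rewrite (split_itv 0%R c)// addeC; congr (_ + _).
have dT (t : R) : is_derive t (1%R : R) (fun t => t + 2 * pi)%R (cst 1%R t).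
  by apply: is_derive_eq; rewrite addr0.
have c1 : continuous (cst 1%R : R -> R) by move=> t; exact: cvg_cst.
have sT (y : R) : exists t, (t + 2 * pi)%R = y.
  by exists (y - 2 * pi)%R; rewrite subrK.
have := ge0_integral_substitution_itv dT c1 (fun=> ltr01) sT 0%R c mfc
  (fun t => f0 (cis t)).
rewrite add0r => ->.
by apply: eq_integral => t _; rewrite cis_2pi mule1.
Qed.

(** The substitution $s=\theta(t)$ maps $[0,2\pi]$ to an interval of length $2\pi$,
    over which the integral of a function of $e^{is}$ is independent of the
    starting point. *)
Lemma ge0_integral_mobius (f : circle R -> \bar R) :
  measurable_fun setT f -> (forall z, 0 <= f z) ->
  \int[mu]_z (f (mobius_circle a1 z) * (poisson a z)%:E) = \int[mu]_z f z.
Proof.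
move=> mf f0.
rewrite !ge0_integral_circle//; first last.
- by move=> z; rewrite mule_ge0// lee_fin ltW// poisson_gt0.
- apply: emeasurable_funM.
    exact: (measurableT_comp mf (measurable_mobius_circle a1)).
  by apply/measurable_EFinP; exact: measurable_poisson.
congr (_ * _).
(* The interval $[\theta(0),\theta(0)+2\pi]$ is the image of $[0,2\pi]$. *)
rewrite -(@integral_cis_shift _ (mobius_lift a 0%R))//; last first.
  by have := mobius_lift_bounds a 0%R; lra.
rewrite -mobius_lift_shift add0r.
rewrite (ge0_integral_substitution_itv (is_derive_mobius_lift a1))//.
- by apply: eq_integral => t _; rewrite (cis_mobius_lift a1).
- exact: continuous_poisson_cis.
- by move=> t; exact: poisson_gt0.
- exact: mobius_lift_surj.
- exact: measurable_comp_cis.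
Qed.

End circle_integral.

(** * The space of square-integrable functions *)

Section L2_theory.
Context d (T : measurableType d) (R : realType).
Variable mu : {measure set T -> \bar R}.
Local Notation H := (L2 mu).
Implicit Types (u v w : H) (f : T -> R[i]).

Lemma L2_square_integrable u : square_integrable mu (repr u).
Proof. by apply/asboolP; exact: (valP (repr u)). Qed.

Lemma L2_ext u v : {ae mu, forall x, repr u x = repr v x} -> u = v.
Proof. by move=> /L2_eqP /eqP; rewrite !reprK. Qed.

Lemma L2class_ae f : square_integrable mu f ->
  {ae mu, forall x, repr (L2class mu f) x = f x}.
Proof.
move=> fi; rewrite /L2class; case: insubP => [g _ gf|].
  by rewrite -gf; exact: L2_reprP.
by move=> /asboolP.
Qed.

Lemma L2add_ae u v : {ae mu, forall x, repr (u + v) x = repr u x + repr v x}.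
Proof. exact: L2_reprP. Qed.

Lemma L2opp_ae u : {ae mu, forall x, repr (- u) x = - repr u x}.
Proof. exact: L2_reprP. Qed.

Lemma L2scale_ae c u : {ae mu, forall x, repr (c *: u) x = c * repr u x}.
Proof. exact: L2_reprP. Qed.

Lemma L2zero_ae : {ae mu, forall x, repr (0 : H) x = 0}.
Proof. exact: L2_reprP. Qed.

(** The square of the norm, as an extended real so that it can be estimated with
    monotonicity of the integral only. *)
Definition energy u : \bar R := (\int[mu]_x (normc (repr u x) ^+ 2)%:E)%E.

Lemma energy_ge0 u : (0 <= energy u)%E.
Proof. by apply: integral_ge0 => x _; rewrite lee_fin sqr_ge0. Qed.

Lemma energy_fin u : energy u \is a fin_num.
Proof.
have [_ _ h] := L2_square_integrable u.
by rewrite ge0_fin_numE// energy_ge0.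
Qed.

Lemma energyE u f : square_integrable mu f ->
  {ae mu, forall x, repr u x = f x} ->
  energy u = (\int[mu]_x (normc (f x) ^+ 2)%:E)%E.
Proof.
move=> [fr fi _] uf; have [ur ui _] := L2_square_integrable u.
apply: ae_eq_integral => //; [exact: measurable_normc2|exact: measurable_normc2|].
by apply: filterS uf => x -> _.
Qed.

Lemma normc_sqr_Re (z : R[i]) : normc z ^+ 2 = Re (z * z^*).
Proof. by rewrite normc2E !complex_partsE; ring. Qed.

Lemma L2normE u : L2norm u = Num.sqrt (fine (energy u)).
Proof.
rewrite /L2norm /L2dot /Cintegral /= /Rintegral /energy.
by under eq_integral do rewrite -normc_sqr_Re.
Qed.

Lemma L2norm2 u : L2norm u ^+ 2 = fine (energy u).
Proof. by rewrite L2normE sqr_sqrtr// fine_ge0// energy_ge0. Qed.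

Lemma energy_eq0 u : energy u = 0%E -> u = 0.
Proof.
have [ur ui _] := L2_square_integrable u.
move=> u0; apply: L2_ext.
have /(ae_eq_integral_abs _ measurableT (measurable_normc2 ur ui)) h :
    (\int[mu]_x `|(normc (repr u x) ^+ 2)%:E| = 0)%E.
  rewrite -u0; apply: eq_integral => x _.
  by rewrite abse_EFin ger0_norm ?sqr_ge0.
apply: filterS2 h L2zero_ae => x + ->.
move=> /(_ Logic.I) [] /eqP; rewrite expf_eq0/= => /eqP.
exact: eq0_normc.
Qed.

Lemma L2dot_eq0 u : L2dot u u = 0 -> u = 0.
Proof.
move=> u0; apply: energy_eq0; rewrite -(fineK (energy_fin u)) -L2norm2.
by rewrite /L2norm u0 sqrtr0 expr0n.
Qed.

(** Both parts of $u\bar v$ are dominated by $|u|^2+|v|^2$. *)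
Let integrable_prod u v (g : T -> R) :
  measurable_fun setT g ->
  (forall x, `|g x| <= normc (repr u x) ^+ 2 + normc (repr v x) ^+ 2) ->
  mu.-integrable setT (EFin \o g).
Proof.
move=> mg gle; have [ur ui uoo] := L2_square_integrable u.
have [vr vi voo] := L2_square_integrable v.
apply/integrableP; split; first exact/measurable_EFinP.
apply: (@le_lt_trans _ _ (energy u + energy v)%E); last first.
  by rewrite lte_add_pinfty.
rewrite /energy -ge0_integralD//; first last.
- exact: measurable_normc2.
- by move=> x _; rewrite lee_fin sqr_ge0.
- exact: measurable_normc2.
- by move=> x _; rewrite lee_fin sqr_ge0.
apply: ge0_le_integral => //.
- exact/measurableT_comp/measurable_EFinP.
- by apply: emeasurable_funD; exact: measurable_normc2.
- by move=> x _; rewrite -EFinD lee_fin.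
Qed.

Lemma integrable_Re_dot u v :
  mu.-integrable setT (fun x => (Re (repr u x * (repr v x)^*))%:E).
Proof.
have [ur ui uoo] := L2_square_integrable u.
have [vr vi voo] := L2_square_integrable v.
apply: (integrable_prod (u := u) (v := v)).
  under eq_fun do rewrite !complex_partsE mulrN opprK.
  by apply: measurable_funD; exact: measurable_funM.
move=> x; rewrite !normc2E !complex_partsE ler_norml.
move: (Re (repr u x)) (Im (repr u x)) (Re (repr v x)) (Im (repr v x)) => p q r s.
have := sqr_ge0 (p - r); have := sqr_ge0 (p + r).
have := sqr_ge0 (q - s); have := sqr_ge0 (q + s).
have := sqr_ge0 p; have := sqr_ge0 q; have := sqr_ge0 r; have := sqr_ge0 s.
lra.
Qed.

Lemma integrable_Im_dot u v :
  mu.-integrable setT (fun x => (Im (repr u x * (repr v x)^*))%:E).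
Proof.
have [ur ui uoo] := L2_square_integrable u.
have [vr vi voo] := L2_square_integrable v.
apply: (integrable_prod (u := u) (v := v)).
  under eq_fun do rewrite !complex_partsE mulrN addrC.
  by apply: measurable_funB; exact: measurable_funM.
move=> x; rewrite !normc2E !complex_partsE ler_norml.
move: (Re (repr u x)) (Im (repr u x)) (Re (repr v x)) (Im (repr v x)) => p q r s.
have := sqr_ge0 (p - s); have := sqr_ge0 (p + s).
have := sqr_ge0 (q - r); have := sqr_ge0 (q + r).
have := sqr_ge0 p; have := sqr_ge0 q; have := sqr_ge0 r; have := sqr_ge0 s.
lra.
Qed.

Lemma L2dotDl u v w : L2dot (u + v) w = L2dot u w + L2dot v w.
Proof.
apply: complex_ext; rewrite ?cReD ?cImD /=.
- rewrite -RintegralD ?integrable_Re_dot//; congr (fine _); apply: ae_eq_integral => //.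
  + exact: (measurable_int _ (integrable_Re_dot _ _)).
  + apply/measurable_EFinP; apply: measurable_funD; apply/measurable_EFinP;
      exact: (measurable_int _ (integrable_Re_dot _ _)).
  + by apply: filterS (L2add_ae u v) => x -> _; rewrite mulrDl cReD.
- rewrite -RintegralD ?integrable_Im_dot//; congr (fine _); apply: ae_eq_integral => //.
  + exact: (measurable_int _ (integrable_Im_dot _ _)).
  + apply/measurable_EFinP; apply: measurable_funD; apply/measurable_EFinP;
      exact: (measurable_int _ (integrable_Im_dot _ _)).
  + by apply: filterS (L2add_ae u v) => x -> _; rewrite mulrDl cImD.
Qed.

Lemma L2dot0l u : L2dot 0 u = 0.
Proof.
by have := L2dotDl 0 0 u; rewrite addr0 => /(congr1 (fun z => z - L2dot 0 u));
  rewrite subrr addrK.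
Qed.

(** If $v$ and $w$ both qualify, then $v-w$ lies in [S] and is orthogonal to
    itself. *)
Lemma orthoproj_unique (S : set H) u v :
  (forall x y, S x -> S y -> S (x - y)) ->
  S v -> orthocomplement S (u - v) -> orthoproj S u = v.
Proof.
move=> SB Sv ov; rewrite /orthoproj; apply: xget_unique => // w [Sw ow].
have Swv := SB _ _ Sw Sv.
apply/eqP; rewrite -subr_eq0; apply/eqP/L2dot_eq0.
have := ov _ Swv; rewrite -(subrK w u) -addrA L2dotDl.
by rewrite ow// add0r.
Qed.

End L2_theory.

(** * Weighted composition operators *)

Section weighted_composition.
Context (R : realType) (a : R[i]) (a1 : `|a| < 1).
Local Notation mu := (circle_measure R).
Local Notation H := (L2 mu).
Local Notation phi := (mobius_circle a1).
Implicit Types (u v : H) (b c : circle R -> R[i]) (f : circle R -> R[i]).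

Let K : R := (1 + normc a) / (1 - normc a).

Let K0 : 0 <= K.
Proof.
apply: divr_ge0; first by rewrite addr_ge0// normc_nonneg.
by rewrite subr_ge0 ltW// normc_lt1.
Qed.

(** By [kappa_bounds], $1/P\le K$. *)
Let poisson_ge z : 1 <= K * poisson a z.
Proof.
have := kappa_bounds a1 z; have := normc_lt1 a1; have := normc_nonneg a.
rewrite (poissonE a1) /K; move: (normc a) (kappa a z) => r k r0 r1 k1.
by rewrite mulf_div ler_pdivlMr; nra.
Qed.

Lemma ge0_integral_mobius_le (f : circle R -> \bar R) :
  measurable_fun setT f -> (forall z, 0 <= f z)%E ->
  (\int[mu]_z f (phi z) <= K%:E * \int[mu]_z f z)%E.
Proof.
move=> mf f0; have mfphi : measurable_fun setT (f \o phi).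
  exact: (measurableT_comp mf (measurable_mobius_circle a1)).
have mp : measurable_fun setT (EFin \o poisson a).
  by apply/measurable_EFinP; exact: measurable_poisson.
have p0 z : 0 <= poisson a z by rewrite ltW// poisson_gt0.
rewrite -[X in (_ <= _ * X)%E](ge0_integral_mobius a1)// -ge0_integralZl//.
- apply: ge0_le_integral => //.
  + by apply: measurable_funeM; exact: emeasurable_funM.
  + move=> z _; rewrite muleCA -[leLHS]mule1 lee_wpmul2l//.
    by rewrite -EFinM lee_fin.
- exact: emeasurable_funM.
- by move=> z _; rewrite mule_ge0// lee_fin.
Qed.

(** The estimate above, applied to the indicator function of a null set, shows that
    its preimage is null. *)
Lemma ae_mobius (P : circle R -> Prop) :
  {ae mu, forall z, P z} -> {ae mu, forall z, P (phi z)}.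
Proof.
move=> [N [mN N0 PN]]; exists (phi @^-1` N); split.
- by rewrite -[X in measurable X]setTI; exact: measurable_mobius_circle.
- apply/eqP; rewrite eq_le measure_ge0 andbT.
  have mphiN : measurable (phi @^-1` N).
    by rewrite -[X in measurable X]setTI; exact: measurable_mobius_circle.
  have mE A : measurable A -> (\int[mu]_z (\1_A z)%:E = mu A)%E.
    by move=> mA; rewrite integral_indic// setIT.
  have := @ge0_integral_mobius_le (fun z => (\1_N z)%:E).
  rewrite (mE N mN) N0 mule0 -(mE _ mphiN); apply => //.
  by apply/measurable_EFinP; exact: measurable_indic.
- by move=> z Pz; apply: PN.
Qed.

(** The bound is put on the square of the modulus because only squares are
    integrated. *)
Definition bounded_mfun b : Prop :=
  [/\ measurable_fun setT (fun z => Re (b z)),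
      measurable_fun setT (fun z => Im (b z)) &
      exists2 M : R, 0 <= M & forall z, normc (b z) ^+ 2 <= M].

Lemma bounded_mfun_cst (l : R[i]) : bounded_mfun (cst l).
Proof.
split; [exact: measurable_cst|exact: measurable_cst|].
by exists (normc l ^+ 2); rewrite ?sqr_ge0.
Qed.

Lemma bounded_mfun_real (r : circle R -> R) (M : R) : measurable_fun setT r ->
  (forall z, `|r z| <= M) -> bounded_mfun (fun z => (r z)%:C).
Proof.
move=> mr rM; split => //; exists (M ^+ 2); rewrite ?sqr_ge0// => z.
rewrite normc2E/= expr0n/= addr0 -[leLHS]real_normK ?num_real//.
by rewrite ler_pXn2r// nnegrE (le_trans _ (rM z)).
Qed.

Lemma bounded_mfunM b c :
  bounded_mfun b -> bounded_mfun c -> bounded_mfun (fun z => b z * c z).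
Proof.
move=> [br bi [M M0 bM]] [cr ci [M' M'0 cM]]; split.
- under eq_fun do rewrite cReM.
  by apply: measurable_funB; exact: measurable_funM.
- under eq_fun do rewrite cImM.
  by apply: measurable_funD; exact: measurable_funM.
- exists (M * M'); rewrite ?mulr_ge0// => z.
  rewrite [X in X <= _](_ : _ = normc (b z) ^+ 2 * normc (c z) ^+ 2).
    by rewrite ler_pM// sqr_ge0.
  by rewrite !normc2E !complex_partsE; ring.
Qed.

Lemma normc2D (z w : R[i]) :
  normc (z + w) ^+ 2 <= 2 * normc z ^+ 2 + 2 * normc w ^+ 2.
Proof.
rewrite !normc2E !complex_partsE.
by have := sqr_ge0 (Re z - Re w); have := sqr_ge0 (Im z - Im w); lra.
Qed.

Lemma bounded_mfunD b c :
  bounded_mfun b -> bounded_mfun c -> bounded_mfun (fun z => b z + c z).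
Proof.
move=> [br bi [M M0 bM]] [cr ci [M' M'0 cM]]; split.
- by under eq_fun do rewrite cReD; exact: measurable_funD.
- by under eq_fun do rewrite cImD; exact: measurable_funD.
- exists (2 * M + 2 * M'); first by rewrite addr_ge0// mulr_ge0.
  by move=> z; rewrite (le_trans (normc2D _ _))// lerD// ler_pM2l.
Qed.

Lemma bounded_mfunN b : bounded_mfun b -> bounded_mfun (fun z => - b z).
Proof.
move=> /(bounded_mfunM (bounded_mfun_cst (- 1))).
by under eq_fun do rewrite /= mulN1r.
Qed.

Lemma bounded_mfun_phi b : bounded_mfun b -> bounded_mfun (b \o phi).
Proof.
have mphi := measurable_mobius_circle a1.
move=> [br bi [M M0 bM]]; split; [exact: (measurableT_comp br mphi)|
  exact: (measurableT_comp bi mphi)|by exists M => //= z].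
Qed.

Definition wsum b c f : circle R -> R[i] := fun z => b z * f z + c z * f (phi z).

(** The bound $|x+y|^2\le 2|x|^2+2|y|^2$ reduces this to the two summands, and
    $\int|f\circ\varphi|^2\le K\int|f|^2$. The constant [M] depends on the weights
    only: it bounds the operator [wcomp] as well. *)
Lemma wsum_bound b c : bounded_mfun b -> bounded_mfun c ->
  exists2 M : R, 0 <= M & forall f, square_integrable mu f ->
  square_integrable mu (wsum b c f) /\
  (\int[mu]_z (normc (wsum b c f z) ^+ 2)%:E <=
     M%:E * \int[mu]_z (normc (f z) ^+ 2)%:E)%E.
Proof.
move=> [br bi [M M0 bM]] [cr ci [M' M'0 cM]].
have mphi := measurable_mobius_circle a1.
have m1 : 0 <= 2 * M by rewrite mulr_ge0.
have m2 : 0 <= 2 * M' by rewrite mulr_ge0.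
have m3 : 0 <= 2 * M' * K by rewrite mulr_ge0.
exists (2 * M + 2 * M' * K); first exact: addr_ge0.
move=> f [fr fi foo].
have fpr := measurableT_comp fr mphi; have fpi := measurableT_comp fi mphi.
have wr : measurable_fun setT (fun z => Re (wsum b c f z)).
  under eq_fun do rewrite cReD !cReM.
  by apply: measurable_funD; apply: measurable_funB; exact: measurable_funM.
have wi : measurable_fun setT (fun z => Im (wsum b c f z)).
  under eq_fun do rewrite cImD !cImM.
  by apply: measurable_funD; apply: measurable_funD; exact: measurable_funM.
have mf := measurable_normc2 fr fi.
have mfp := measurable_normc2 fpr fpi.
have f0 z : (0 <= (normc (f z) ^+ 2)%:E)%E by rewrite lee_fin sqr_ge0.
have I0 : (0 <= \int[mu]_z (normc (f z) ^+ 2)%:E)%E by exact: integral_ge0.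
have le : (\int[mu]_z (normc (wsum b c f z) ^+ 2)%:E <=
     (2 * M + 2 * M' * K)%:E * \int[mu]_z (normc (f z) ^+ 2)%:E)%E.
  apply: (@le_trans _ _ (\int[mu]_z ((2 * M)%:E * (normc (f z) ^+ 2)%:E +
      (2 * M')%:E * (normc (f (phi z)) ^+ 2)%:E))%E).
    apply: ge0_le_integral => //.
    - by move=> z _; rewrite lee_fin sqr_ge0.
    - exact: measurable_normc2.
    - by apply: emeasurable_funD; exact: measurable_funeM.
    - move=> z _; rewrite -!EFinM -EFinD lee_fin.
      rewrite (le_trans (normc2D _ _))// -!mulrA -!mulrDr ler_pM2l//.
      have nM (x y : R[i]) : normc (x * y) ^+ 2 = normc x ^+ 2 * normc y ^+ 2.
        by rewrite !normc2E !complex_partsE; ring.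
      by rewrite !nM lerD// ler_wpM2r// sqr_ge0.
  rewrite ge0_integralD//; first last.
  - exact: measurable_funeM.
  - by move=> z _; rewrite mule_ge0// lee_fin sqr_ge0.
  - exact: measurable_funeM.
  - by move=> z _; rewrite mule_ge0// lee_fin sqr_ge0.
  rewrite !ge0_integralZl//.
  rewrite EFinD ge0_muleDl ?lee_fin//.
  rewrite leeD2l// [(2 * M' * K)%:E]EFinM -muleA lee_wpmul2l//.
  exact: (@ge0_integral_mobius_le (fun z => (normc (f z) ^+ 2)%:E)).
split => //; split => //.
by rewrite (le_lt_trans le)// lte_mul_pinfty// lee_fin addr_ge0.
Qed.

Definition wcomp b c u : H := L2class mu (wsum b c (repr u)).

Lemma wcomp_ae b c u : bounded_mfun b -> bounded_mfun c ->
  {ae mu, forall z, repr (wcomp b c u) z = wsum b c (repr u) z}.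
Proof.
move=> bb bc; have [M _ h] := wsum_bound bb bc.
by apply: L2class_ae; have [] := h _ (L2_square_integrable u).
Qed.

Lemma wcomp_linear b c : bounded_mfun b -> bounded_mfun c -> linear (wcomp b c).
Proof.
move=> bb bc l u v; apply: L2_ext.
have aeuv : {ae mu, forall z, repr (l *: u + v) z = l * repr u z + repr v z}.
  by apply: filterS2 (L2add_ae (l *: u) v) (L2scale_ae l u) => z -> ->.
near=> z.
rewrite (near (wcomp_ae (l *: u + v) bb bc) z)//.
rewrite (near (L2add_ae (l *: wcomp b c u) (wcomp b c v)) z)//.
rewrite (near (L2scale_ae l (wcomp b c u)) z)//.
rewrite (near (wcomp_ae u bb bc) z)// (near (wcomp_ae v bb bc) z)//.
rewrite /wsum (near aeuv z)// (near (ae_mobius aeuv) z)//.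
ring.
Unshelve. all: by end_near. Qed.

(** The terms $u\circ\varphi\circ\varphi$ produced by the composition are equal to
    $u$; this is what keeps the class of operators closed. *)
Lemma wcomp_comp b c b' c' u :
  bounded_mfun b -> bounded_mfun c -> bounded_mfun b' -> bounded_mfun c' ->
  wcomp b c (wcomp b' c' u) =
  wcomp (fun z => b z * b' z + c z * c' (phi z))
        (fun z => b z * c' z + c z * b' (phi z)) u.
Proof.
move=> bb bc bb' bc'; apply: L2_ext.
have inner := wcomp_ae u bb' bc'.
have outer := wcomp_ae (wcomp b' c' u) bb bc.
have B1 := bounded_mfunD (bounded_mfunM bb bb')
  (bounded_mfunM bc (bounded_mfun_phi bc')).
have B2 := bounded_mfunD (bounded_mfunM bb bc')
  (bounded_mfunM bc (bounded_mfun_phi bb')).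
near=> z.
rewrite (near outer z)// (near (wcomp_ae u B1 B2) z)//.
rewrite /wsum (near inner z)// (near (ae_mobius inner) z)//.
by rewrite /wsum mobius_circleK/=; ring.
Unshelve. all: by end_near. Qed.

Lemma wcompB b c b' c' u :
  bounded_mfun b -> bounded_mfun c -> bounded_mfun b' -> bounded_mfun c' ->
  wcomp b c u - wcomp b' c' u =
  wcomp (fun z => b z - b' z) (fun z => c z - c' z) u.
Proof.
move=> bb bc bb' bc'; apply: L2_ext.
have B1 := bounded_mfunD bb (bounded_mfunN bb').
have B2 := bounded_mfunD bc (bounded_mfunN bc').
near=> z.
rewrite (near (L2add_ae (wcomp b c u) (- wcomp b' c' u)) z)//.
rewrite (near (L2opp_ae (wcomp b' c' u)) z)//.
rewrite (near (wcomp_ae u bb bc) z)// (near (wcomp_ae u bb' bc') z)//.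
by rewrite (near (wcomp_ae u B1 B2) z)// /wsum; ring.
Unshelve. all: by end_near. Qed.

Lemma wcomp_cst l u : wcomp (cst l) (cst 0) u = l *: u.
Proof.
apply: L2_ext.
have B1 := bounded_mfun_cst l; have B2 := bounded_mfun_cst 0.
apply: filterS2 (wcomp_ae u B1 B2) (L2scale_ae l u) => z -> ->.
by rewrite /wsum/= mul0r addr0.
Qed.

Lemma eq_wcomp b c b' c' u : b =1 b' -> c =1 c' -> wcomp b c u = wcomp b' c' u.
Proof. by move=> /funext -> /funext ->. Qed.

Lemma Cmobius_wcomp u : Cmobius a1 u = wcomp (cst 0) (cst 1) u.
Proof.
rewrite /Cmobius /composition_operator /wcomp; congr (L2class _ _).
by apply/funext => z; rewrite /wsum /= mul0r add0r mul1r.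
Qed.

Lemma wcomp_bounded b c : bounded_mfun b -> bounded_mfun c ->
  exists M : R, forall u, L2norm (wcomp b c u) <= M * L2norm u.
Proof.
move=> bb bc; have [M M0 h] := wsum_bound bb bc.
exists (Num.sqrt M) => u; rewrite !L2normE -sqrtrM// ler_wsqrtr//.
have [hi hle] := h _ (L2_square_integrable u).
have uE := energyE hi (wcomp_ae u bb bc).
by rewrite -lee_fin EFinM !fineK ?energy_fin// uE.
Qed.

Lemma wcomp_linear_operator b c : bounded_mfun b -> bounded_mfun c ->
  exists B : {linear H -> H}, B = wcomp b c :> (H -> H).
Proof.
move=> bb bc.
pose mixin := GRing.isLinear.Build _ _ _ _ _ (wcomp_linear bb bc).
pose B : {linear H -> H} := HB.pack (wcomp b c) mixin.
by exists B.
Qed.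

End weighted_composition.

(** * Level sets of the normalized kernel *)

Section level_sets.
Context (R : realType).
Local Notation mu := (circle_measure R).
Local Notation leb := (@lebesgue_measure R).

Lemma measurable_preimage_cis (A : set (circle R)) : measurable A ->
  measurable ((fun t : R => cis t) @^-1` A : set R).
Proof. by move=> mA; rewrite -[X in measurable X]setTI; exact: (@measurable_cis R). Qed.

Lemma circle_measure_arc (c : R) (A : set (circle R)) :
  0 <= c <= 2 * pi -> measurable A ->
  mu A = ((2 * pi)^-1%:E *
    leb ((fun t => cis t) @^-1` A `&` `[c, (c + 2 * pi)%R]))%E.
Proof.
move=> c0 mA; have mcA := measurable_preimage_cis mA.
have mI : measurable_fun setT (fun z => (\1_A z)%:E : \bar R).
  by apply/measurable_EFinP; exact: measurable_indic.
have I0 (z : circle R) : (0 <= (\1_A z)%:E :> \bar R)%E by rewrite lee_fin.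
have -> : mu A = (\int[mu]_z (\1_A z)%:E)%E by rewrite integral_indic// setIT.
rewrite ge0_integral_circle//.
rewrite -(integral_cis_shift mI I0 c0); congr (_ * _)%E.
by rewrite -integral_indic.
Qed.

(** On $[0,2\pi]$ the equation $\cos t=x$ has at most the two solutions
    $\arccos x$ and $2\pi-\arccos x$. *)
Lemma circle_measure_Re (x : R) : mu [set z | Re z = x] = 0%E.
Proof.
have mA : measurable [set z : circle R | Re z = x].
  rewrite -[X in measurable X]setTI.
  exact: (measurable_circle_Re measurableT (measurable_set1 x)).
rewrite (@circle_measure_arc 0)// ?lexx ?(ltW (gt0_2pi R))// add0r.
rewrite [X in (_ * X)%E](_ : _ = 0%E) ?mule0//.
have m2 : measurable ([set acos x] `|` [set 2 * pi - acos x] : set (measurableTypeR R)).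
  by apply: measurableU; exact: measurable_set1.
apply/eqP; rewrite eq_le measure_ge0 andbT.
apply: (@le_trans _ _ (leb ([set acos x] `|` [set 2 * pi - acos x]))).
  apply: le_measure; rewrite ?inE//=.
  - by apply: measurableI => //; exact: measurable_preimage_cis.
  - move=> t /= [tx]; rewrite in_itv/= => /andP[t0 t2].
    have [tp|tp] := leP t pi.
      by left; rewrite -tx cosK// in_itv/= t0.
    right; have -> : acos x = 2 * pi - t; last by ring.
    rewrite -tx -[cos t]cosN -(cosD2pi (- t)) addrC cosK; first by ring.
    by rewrite in_itv/= -mulr_natl; apply/andP; split; lra.
apply: le_trans; first by apply: measureU2; exact: measurable_set1.
rewrite [leLHS](congr2 (fun p q => p + q)%E (lebesgue_measure_set1 (acos x))
  (lebesgue_measure_set1 (2 * pi - acos x))).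
by rewrite adde0.
Qed.

Context (a : R[i]) (a1 : `|a| < 1) (a0 : a != 0).

Lemma normc_gt0 : 0 < normc a.
Proof.
by rewrite lt_neqAle normc_nonneg andbT eq_sym; apply: contra a0 => /eqP/eq0_normc ->.
Qed.

(** With $w$ the imaginary part of $\bar a z$, the real part of $\bar a z$ determines
    $w$ up to sign since $|\bar a z|=|a|$, hence leaves two values for the real
    part of $z$. *)
Lemma circle_measure_rdot (x : R) : mu.-negligible [set z | rdot a z = x].
Proof.
pose r2 := normc a ^+ 2; pose y := Num.sqrt (r2 - x ^+ 2).
have r0 : 0 < r2 by rewrite exprn_gt0// normc_gt0.
pose N p := [set z : circle R | Re z = p].
have mN p : measurable (N p).
  rewrite -[X in measurable X]setTI.
  exact: (measurable_circle_Re measurableT (measurable_set1 p)).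
have nN p : mu.-negligible (N p).
  by apply/negligibleP => //; exact: circle_measure_Re.
apply: (@negligibleS _ _ _ _ (N ((Re a * x - Im a * y) / r2) `|`
    N ((Re a * x + Im a * y) / r2))); last exact: negligibleU.
move=> z /= zx; pose w := Re a * Im z - Im a * Re z.
have z1 := circle_norm2 z.
have w2 : w ^+ 2 = r2 - x ^+ 2.
  rewrite -zx /r2 normc2E -[Re a ^+ 2 + _]mulr1 -z1 /w /rdot; ring.
have : (w == y) || (w == - y).
  by rewrite -eqf_sqr w2 sqr_sqrtr// -w2 sqr_ge0.
have zE : Re z = (Re a * x - Im a * w) / r2.
  apply: (canRL (mulfK (lt0r_neq0 r0))); rewrite -zx /r2 normc2E /w /rdot; ring.
by move=> /orP[] /eqP wy; [left|right]; rewrite /N/= zE wy// mulrN opprK.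
Qed.

Lemma kappa_level (k : R) z : kappa a z = k ->
  rdot a z = (k + normc a ^+ 2) / (1 + k).
Proof.
move=> kE; have kk := kappa_lt1 a1 z; rewrite kE in kk.
have k1 : 1 + k != 0 by rewrite gt_eqF//; lra.
apply: (canRL (mulfK k1)); have z1 := rdot_lt1 a1 z.
have : kappa a z * (1 - rdot a z) = rdot a z - normc a ^+ 2.
  by rewrite /kappa divfK// gt_eqF// subr_gt0.
by rewrite kE; lra.
Qed.

Lemma kappa2_level_ae (l : R[i]) :
  {ae mu, forall z, (1 - kappa a z ^+ 2)%:C - l != 0}.
Proof.
pose k := Num.sqrt (1 - Re l).
apply: (@negligibleS _ _ _ _
  ([set z | rdot a z = (k + normc a ^+ 2) / (1 + k)] `|`
   [set z | rdot a z = (- k + normc a ^+ 2) / (1 - k)])); last first.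
  by apply: negligibleU; exact: circle_measure_rdot.
move=> z /= /negP; rewrite negbK subr_eq0 => /eqP zl.
have lE : Re l = 1 - kappa a z ^+ 2 by rewrite -zl.
have : (kappa a z == k) || (kappa a z == - k).
  by rewrite -eqf_sqr /k lE subKr sqr_sqrtr ?sqr_ge0.
by move=> /orP[] /eqP /kappa_level h; [left|right].
Qed.

Lemma cis_surj (z : circle R) : exists2 t, 0 <= t <= 2 * pi & cis t = z.
Proof.
have z1 := circle_norm2 z; have p0 := @pi_gt0 R.
have zb : -1 <= Re z <= 1.
  by have := sqr_ge0 (Im z); move: (Re z) (Im z) z1 => x y z1 y0; nra.
have t0 := acos_ge0 zb; have tp := acos_lepi zb.
have sE : sin (acos (Re z)) = `|Im z|.
  by rewrite sin_acos// -z1 addrC addKr sqrtr_sqr.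
have cE : cos (acos (Re z)) = Re z by rewrite acosK// in_itv.
have [y0|y0] := leP 0 (Im z).
  exists (acos (Re z)); first by apply/andP; split; lra.
  by apply/val_inj/complex_ext => /=; rewrite ?cE// sE ger0_norm.
exists (2 * pi - acos (Re z)); first by apply/andP; split; lra.
apply/val_inj/complex_ext => /=; rewrite mulr_natl addrC ?cosD2pi ?sinD2pi.
  by rewrite cosN cE.
by rewrite sinN sE ltr0_norm// opprK.
Qed.

Lemma continuous_kappa_cis : continuous (fun t : R => kappa a (cis t)).
Proof.
have -> : (fun t => kappa a (cis t)) =
    (fun t => (poisson a (cis t) - 1) * (poisson a (cis t) + 1)^-1).
  apply/funext => t; rewrite (poissonE a1).
  by have := kappa_lt1 a1 (cis t); move: (kappa _ _) => k k1; field; lra.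
move=> t.
have cp := @continuous_poisson_cis R a a1 t.
have c1 : {for t, continuous (cst (1 : R) : R -> R)} by exact: cvg_cst.
have p0 : (poisson a (cis t) + 1) != 0.
  by rewrite gt_eqF// addr_gt0// poisson_gt0.
exact: (continuousM (continuousB cp c1)
  (@continuousV _ _ ((fun t => poisson a (cis t)) + cst 1) t p0
     (continuousD cp c1))).
Qed.

Lemma measurable_kappa_between (k1 k2 : R) :
  measurable [set z | k1 < kappa a z < k2].
Proof.
rewrite (_ : mkset _ = kappa a @^-1` `]k1, k2[).
  by rewrite -[X in measurable X]setTI; apply: measurable_kappa.
by apply/seteqP; split => z /=; rewrite in_itv.
Qed.

(** Along the circle $\kappa$ goes continuously from $|a|$ at $a/|a|$ to $-|a|$ at
    $-a/|a|$, so it takes the value $(k_1+k_2)/2$; the open set where it stays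
    between $k_1$ and $k_2$ then contains an arc. *)
Lemma kappa_between_gt0 (k1 k2 : R) : 0 <= k1 -> k1 < k2 -> k2 <= normc a ->
  (0 < mu [set z | (k1 < kappa a z < k2)%R])%E.
Proof.
move=> k10 k12 k2a; have r0 := normc_gt0; have r1 := normc_lt1 a1.
have p0 := @pi_gt0 R.
have a2 : Re a ^+ 2 + Im a ^+ 2 = normc a ^+ 2 by rewrite normc2E.
have zp : `|(Re a / normc a) +i* (Im a / normc a)| == 1.
  rewrite normc_def/= !expr_div_n -mulrDl a2 divff ?sqrtr1//.
  by rewrite expf_neq0// gt_eqF.
have [c c0 cz] := cis_surj (Circle zp).
have rc : rdot a (cis c) = normc a.
  rewrite cz /rdot/= !mulrA -mulrDl -!expr2 a2 expr2 mulfK// gt_eqF//.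
have rcpi : rdot a (cis (c + pi)) = - normc a.
  by rewrite -rc /rdot/= cosDpi sinDpi; ring.
have kc : kappa a (cis c) = normc a.
  by rewrite /kappa rc; field; lra.
have kcpi : kappa a (cis (c + pi)) = - normc a.
  by rewrite /kappa rcpi; field; lra.
have [||| t tI kt] := @IVT R (fun t => kappa a (cis t)) c (c + pi) ((k1 + k2) / 2).
- by rewrite lerDl ltW.
- exact/continuous_subspaceT/continuous_kappa_cis.
- by rewrite kc kcpi ge_min le_max; apply/andP; split; apply/orP; [right|left]; lra.
have {tI} tI : c < t < c + pi.
  move: tI; rewrite in_itv/= !le_eqVlt => /andP[/predU1P[ct|->] /predU1P[tc|->]] //;
  exfalso; move: kt; rewrite -?ct ?tc ?kc ?kcpi; lra.
pose A := [set z : circle R | (k1 < kappa a z < k2)%R].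
have mA : measurable A := measurable_kappa_between k1 k2.
have oI : open (((fun t : R => kappa a (cis t)) @^-1` `]k1, k2[) `&` `]c, c + pi[).
  apply: openI; last exact: interval_open.
  by move/continuousP : continuous_kappa_cis; apply; exact: interval_open.
rewrite (circle_measure_arc c0 mA); apply: mule_gt0.
  by rewrite lte_fin invr_gt0 mulr_gt0.
have : nbhs t (((fun t : R => kappa a (cis t)) @^-1` `]k1, k2[) `&` `]c, c + pi[).
  apply: open_nbhs_nbhs; split => //; split => /=; rewrite in_itv//= kt; lra.
move=> [e /= e0 be].
apply: (@lt_le_trans _ _ (leb (`]t - e, t + e[ : set R))).
  rewrite lebesgue_measure_itv/= lte_fin ifT -?EFinD ?lte_fin; lra.
apply: le_measure; rewrite ?inE//=.
  by apply: measurableI => //; exact: measurable_preimage_cis.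
move=> s /=; rewrite in_itv/= => /andP[s1 s2].
have [|h1 h2] := be s; first by rewrite /ball_/= ltr_norml; lra.
move: h1 h2; rewrite /= !in_itv/= => h1 /andP[h2 h3].
by split => //; rewrite (ltW h2)/=; lra.
Qed.

End level_sets.

(** * The orthogonal projections and their difference *)

Section projections.
Context (R : realType) (a : R[i]) (a1 : `|a| < 1).
Local Notation mu := (circle_measure R).
Local Notation H := (L2 mu).
Local Notation phi := (mobius_circle a1).
Local Notation C := (Cmobius a1).
Implicit Types (u v : H).

(** The hypothesis exchanges the positive and the negative parts of [r] under the
    change of variables, so their integrals are equal; their difference has real
    part $0$ even when both are infinite. *)
Lemma Rintegral_antisymmetric (r : circle R -> R) : measurable_fun setT r ->
  {ae mu, forall z, r (phi z) * poisson a z = - r z} ->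
  (\int[mu]_z r z)%R = 0.
Proof.
move=> mr anti; rewrite /Rintegral integralE.
have mE : measurable_fun setT (EFin \o r) by apply/measurable_EFinP.
have mphi := measurable_mobius_circle a1.
have mp := measurable_funepos mE; have mn := measurable_funeneg mE.
have p0 z : 0 <= poisson a z by rewrite ltW// poisson_gt0.
have -> : (\int[mu]_z (EFin \o r)^\+ z = \int[mu]_z (EFin \o r)^\- z)%E.
  rewrite -(ge0_integral_mobius a1)//; apply: ae_eq_integral => //.
    apply: emeasurable_funM; first exact: (measurableT_comp mp mphi).
    by apply/measurable_EFinP; exact: measurable_poisson.
  apply: filterS anti => z rz _.
  rewrite funeposE funenegE /= -rz (EFinM (r (phi z))).
  by rewrite maxe_pMl ?mul0e// lee_fin.
(* For $x=+\infty$ this holds because [fine] is $0$ at infinite values. *)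
have finexx (x : \bar R) : fine (x - x)%E = 0.
  by case: x => //= x; rewrite subrr.
exact: finexx.
Qed.

Lemma Cintegral_antisymmetric (g : circle R -> R[i]) :
  measurable_fun setT (fun z => Re (g z)) ->
  measurable_fun setT (fun z => Im (g z)) ->
  {ae mu, forall z, g (phi z) * (poisson a z)%:C = - g z} ->
  Cintegral mu g = 0.
Proof.
move=> gr gi anti; apply: complex_ext; rewrite /=.
- apply: Rintegral_antisymmetric => //; apply: filterS anti => z.
  by move=> /(congr1 (@complex.Re R)); rewrite !complex_partsE/= mulr0 subr0.
- apply: Rintegral_antisymmetric => //; apply: filterS anti => z.
  by move=> /(congr1 (@complex.Im R)); rewrite !complex_partsE/= mulr0 add0r.
Qed.

Lemma bounded_mfun_kappa (p q : R) : bounded_mfun (fun z => (p + q * kappa a z)%:C).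
Proof.
apply: (@bounded_mfun_real _ _ (`|p| + `|q|)).
  apply: measurable_funD => //; apply: measurable_funM => //.
  exact: measurable_kappa.
move=> z; rewrite (le_trans (ler_normD _ _))// lerD// normrM ler_piMr//.
by have := kappa_lt1 a1 z; rewrite ler_norml; lra.
Qed.

(** Treats both nullspaces at once: $N(C_a-I)$ is the case $1$ and $N(C_a+I)$ the
    case $-1$ of [sg]. *)
Definition symspace (sg : R) : set H := [set u | C u = sg%:C *: u].

Lemma nullspace_fixed : nullspace (C \- id) = symspace 1.
Proof.
apply/seteqP; split => u /=; rewrite /nullspace /symspace /= scale1r.
  by move=> /eqP; rewrite subr_eq0 => /eqP.
by move=> ->; rewrite subrr.
Qed.

Lemma nullspace_negated : nullspace (C \+ id) = symspace (- 1).
Proof.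
apply/seteqP; split => u /=; rewrite /nullspace /symspace /= rmorphN scaleN1r.
  by move=> /eqP; rewrite addr_eq0 => /eqP.
by move=> ->; rewrite addNr.
Qed.

Lemma Cmobius_ae u : {ae mu, forall z, repr (C u) z = repr u (phi z)}.
Proof.
rewrite Cmobius_wcomp.
apply: filterS (wcomp_ae a1 u (bounded_mfun_cst 0) (bounded_mfun_cst 1)) => z ->.
by rewrite /wsum/= mul0r add0r mul1r.
Qed.

Lemma CmobiusB u v : C (u - v) = C u - C v.
Proof.
rewrite !Cmobius_wcomp.
have h := wcomp_linear a1 (bounded_mfun_cst 0) (bounded_mfun_cst 1).
by rewrite addrC -scaleN1r h scaleN1r addrC.
Qed.

Lemma symspaceB sg u v : symspace sg u -> symspace sg v ->
  symspace sg (u - v).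
Proof. by rewrite /symspace/= CmobiusB => -> ->; rewrite scalerBr. Qed.

(** This is $\frac12\big((1-\kappa)\,u + s\,(1+\kappa)\,u\circ\varphi\big)$. Written
    with $P$ it is $(u+s\,P\,u\circ\varphi)/(1+P)$, the average of $u$ and
    $s\,u\circ\varphi$ with weights proportional to the densities of normalized
    Lebesgue measure and of its image under $\varphi$. The weights are kept in the
    form $p+q\kappa$ so that [bounded_mfun_kappa] applies to them. *)
Definition symproj (sg : R) : H -> H :=
  wcomp a1 (fun z => (2^-1 + - 2^-1 * kappa a z)%:C)
           (fun z => (sg / 2 + sg / 2 * kappa a z)%:C).

Lemma symproj_ae sg u : {ae mu, forall z, repr (symproj sg u) z =
  wsum a1 (fun z => (2^-1 + - 2^-1 * kappa a z)%:C)
           (fun z => (sg / 2 + sg / 2 * kappa a z)%:C) (repr u) z}.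
Proof. by apply: wcomp_ae; exact: bounded_mfun_kappa. Qed.

Lemma symproj_symspace sg u : sg * sg = 1 -> symspace sg (symproj sg u).
Proof.
move=> sg2; rewrite /symspace/= Cmobius_wcomp -(wcomp_cst a1) /symproj.
have B p q := bounded_mfun_kappa p q; have Bc l := @bounded_mfun_cst R l.
rewrite !wcomp_comp//; apply: eq_wcomp => z /=; rewrite kappa_mobius;
  apply: complex_ext; rewrite !complex_partsE/=; try ring.
have e x : x = sg * sg * x by rewrite sg2 mul1r.
by rewrite [LHS]e; ring.
Qed.

(** Almost everywhere $u-\mathrm{symproj}\,u=\frac{1+\kappa}2(u-s\,u\circ\varphi)$,
    and $(u-s\,u\circ\varphi)\bar v$ changes sign under $\varphi$ when
    $v\circ\varphi=s\,v$. Since $P=(1+\kappa)/(1-\kappa)$, the factor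
    $1+\kappa$ compensates the density of the change of variables. *)
Lemma symproj_orthogonal sg u v : sg * sg = 1 -> symspace sg v ->
  L2dot (u - symproj sg u) v = 0.
Proof.
move=> sg2 Sv; set w := u - symproj sg u.
have [wr wi _] := L2_square_integrable w.
have [vr vi _] := L2_square_integrable v.
have aew : {ae mu, forall z, repr w z =
    ((1 + kappa a z) / 2)%:C * (repr u z - sg%:C * repr u (phi z))}.
  near=> z.
  rewrite (near (L2add_ae u (- symproj sg u)) z)// (near (L2opp_ae (symproj sg u)) z)//.
  rewrite (near (symproj_ae sg u) z)// /wsum.
  by apply: complex_ext; rewrite !complex_partsE/=; field.
have aev : {ae mu, forall z, repr v (phi z) = sg%:C * repr v z}.
  near=> z; rewrite -(near (Cmobius_ae v) z)// Sv.
  by rewrite (near (L2scale_ae sg%:C v) z).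
apply: Cintegral_antisymmetric.
- under eq_fun do rewrite !complex_partsE mulrN opprK.
  by apply: measurable_funD; exact: measurable_funM.
- under eq_fun do rewrite !complex_partsE mulrN addrC.
  by apply: measurable_funB; exact: measurable_funM.
near=> z.
rewrite (near aew z)// (near (ae_mobius a1 aew) z)// (near aev z)//.
rewrite mobius_circleK kappa_mobius (poissonE a1).
have k1 := kappa_lt1 a1 z; move: (kappa a z) k1 => k k1.
have /orP[] : (sg == 1) || (sg == -1) by rewrite -sqrf_eq1 expr2 sg2.
all: move=> /eqP->.
all: apply: complex_ext; rewrite !complex_partsE/= !(mulr0, mul0r, subr0, addr0, add0r).
all: field; lra.
Unshelve. all: by end_near. Qed.

Lemma orthoproj_symspace sg u : sg * sg = 1 ->
  orthoproj (symspace sg) u = symproj sg u.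
Proof.
move=> sg2; apply: orthoproj_unique.
- exact: symspaceB.
- exact: symproj_symspace.
- by move=> v; exact: symproj_orthogonal.
Qed.

Definition projdiff : H -> H :=
  wcomp a1 (cst 0) (fun z => (1 + 1 * kappa a z)%:C).

Lemma orthoproj_sub :
  orthoproj (nullspace (C \- id)) \- orthoproj (nullspace (C \+ id)) = projdiff.
Proof.
apply/funext => u; rewrite /= nullspace_fixed nullspace_negated.
rewrite !orthoproj_symspace ?mulr1 ?mulrNN ?mulr1//.
have B p q := bounded_mfun_kappa p q.
rewrite /symproj wcompB//; apply: eq_wcomp => z;
  by apply: complex_ext; rewrite !complex_partsE/=; field.
Qed.

Lemma projdiff_shift l u : projdiff u - l *: u =
  wcomp a1 (cst (- l)) (fun z => (1 + 1 * kappa a z)%:C) u.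
Proof.
have B p q := bounded_mfun_kappa p q; have Bc l := @bounded_mfun_cst R l.
rewrite -(wcomp_cst a1) /projdiff wcompB//.
by apply: eq_wcomp => z /=; rewrite ?sub0r ?subr0.
Qed.

End projections.

(** * Eigenvalues and spectrum *)

Section spectrum.
Context (R : realType) (a : R[i]) (a1 : `|a| < 1) (a0 : a != 0).
Local Notation mu := (circle_measure R).
Local Notation H := (L2 mu).
Local Notation phi := (mobius_circle a1).
Local Notation C := (Cmobius a1).
Local Notation D := (projdiff a1).
Implicit Types (u v : H) (l : R[i]).

Lemma projdiff_ae u :
  {ae mu, forall z, repr (D u) z = (1 + kappa a z)%:C * repr u (phi z)}.
Proof.
apply: filterS (wcomp_ae a1 u (bounded_mfun_cst 0) (bounded_mfun_kappa a1 1 1)) => z ->.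
by rewrite /wsum/= mul0r add0r mul1r.
Qed.

(** Iterating $Du=lu$ gives $(1-\kappa^2)u=l^2u$. *)
Lemma projdiff_no_eigenvalue l : ~ operator_eigenvalue D l.
Proof.
case=> u u0 Du; move/eqP: u0; apply; apply: L2_ext.
have aeu : {ae mu, forall z, (1 + kappa a z)%:C * repr u (phi z) = l * repr u z}.
  near=> z; rewrite -(near (projdiff_ae u) z)// Du.
  by rewrite (near (L2scale_ae l u) z).
have aez : {ae mu, forall z, repr u z = 0}.
  apply: filterS3 aeu (ae_mobius a1 aeu) (kappa2_level_ae a1 a0 (l * l)) => z.
  rewrite mobius_circleK kappa_mobius => e2 e1 n0.
  apply: (mulfI n0); rewrite mulr0 mulrBl -mulrA -e2 mulrCA -e1.
  by apply/eqP; rewrite subr_eq0; apply/eqP/complex_ext; rewrite !complex_partsE/=; ring.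
by apply: filterS2 aez (@L2zero_ae _ _ _ mu) => z -> ->.
Unshelve. all: by end_near. Qed.

Lemma symspace0 (s : R) : symspace a1 s 0.
Proof. by rewrite /symspace/= scaler0; have := CmobiusB a1 0 0; rewrite !subrr. Qed.

(** Such a vector is fixed by one projection and killed by the other, hence is an
    eigenvector of $D$ for the eigenvalue [s] unless it is zero. *)
Lemma symspace_meets_orthocomplement (s s' : R) : s * s = 1 -> s' = - s ->
  symspace a1 s `&` orthocomplement (symspace a1 s') = [set 0].
Proof.
move=> s2 s'E; apply/seteqP; split=> [u [Su ou]|_ ->]; last first.
  by split; [exact: symspace0|move=> v _; exact: L2dot0l].
have pu : symproj a1 s u = u.
  rewrite -orthoproj_symspace//; apply: orthoproj_unique => //.
    exact: symspaceB.
  by move=> v _; rewrite subrr L2dot0l.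
have pu' : symproj a1 s' u = 0.
  rewrite -orthoproj_symspace; last by rewrite s'E mulrNN.
  apply: orthoproj_unique; [exact: symspaceB|exact: symspace0|].
  by rewrite subr0.
have Du : D u = s%:C *: u.
  rewrite -orthoproj_sub /= nullspace_fixed nullspace_negated.
  rewrite !orthoproj_symspace ?mulrNN ?mulr1//.
  have /orP[/eqP sE|/eqP sE] : (s == 1) || (s == -1).
    by rewrite -sqrf_eq1 expr2 s2.
  - by rewrite -sE -s'E pu pu' subr0 sE scale1r.
  - by move: pu pu'; rewrite s'E sE opprK => -> ->; rewrite sub0r rmorphN scaleN1r.
apply: contrapT => /eqP u0; apply: (@projdiff_no_eigenvalue s%:C).
by exists u.
Qed.

(** The window is placed just below $k_0=\sqrt{1-x^2}$, or just above $0$ when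
    $k_0=0$. Only nonnegative values are used so that the part of the circle where
    $\kappa$ lies in the window is disjoint from its image under $\varphi$. *)
Lemma kappa_window (x e : R) : 1 - normc a ^+ 2 <= x ^+ 2 <= 1 -> 0 < e ->
  exists k1 k2 : R, [/\ 0 <= k1, k1 < k2, k2 <= normc a &
    forall k, k1 < k < k2 -> `|1 - k ^+ 2 - x ^+ 2| <= e].
Proof.
move=> /andP[x1 x2] e0; have r0 := normc_gt0 a0; have r1 := normc_lt1 a1.
pose k0 := Num.sqrt (1 - x ^+ 2).
have k00 : 0 <= k0 by exact: sqrtr_ge0.
have k02 : k0 ^+ 2 = 1 - x ^+ 2 by rewrite sqr_sqrtr// subr_ge0.
have k0r : k0 <= normc a.
  by rewrite -(ler_pXn2r (n := 2))// ?nnegrE ?(ltW r0)// k02; lra.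
have kE k : 1 - k ^+ 2 - x ^+ 2 = (k0 - k) * (k0 + k).
  by rewrite addrAC -k02; ring.
have [k0p|k0n] := ltP 0 k0.
  exists (Num.max 0 (k0 - e / 2)), k0; split => //.
  - by rewrite le_max lexx.
  - by rewrite gt_max k0p/=; lra.
  - move=> k; rewrite gt_max => /andP[/andP[h1 h2] h3].
    by rewrite kE ger0_norm; [nra|apply: mulr_ge0; lra].
have k0E : k0 = 0 by apply/eqP; rewrite eq_le k0n k00.
exists 0, (Num.min (normc a) (Num.min 1 e)); split => //.
- by rewrite !lt_min r0 e0 ltr01.
- by rewrite ge_min lexx.
- move=> k; rewrite !lt_min => /and4P[h1 h2 h3 h4].
  by rewrite kE k0E ler0_norm; nra.
Qed.

(** If $l^2$ is not real, its imaginary part is a gap. If it is real and outside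
    $[1-|a|^2,1]$, the distance to this interval is a gap. If it is inside, then it
    is positive and [l] is real, which is excluded. *)
Lemma resolvent_gap l :
  (forall x : R, 1 - normc a ^+ 2 <= x ^+ 2 <= 1 -> l != x%:C) ->
  exists2 d : R, 0 < d & forall k : R, - normc a <= k <= normc a ->
    d <= normc ((1 - k ^+ 2)%:C - l * l) ^+ 2.
Proof.
case: l => p q h.
have r0 := normc_gt0 a0; have r1 := normc_lt1 a1.
have nE (k : R) : normc ((1 - k ^+ 2)%:C - (p +i* q) * (p +i* q)) ^+ 2 =
    (1 - k ^+ 2 - (p ^+ 2 - q ^+ 2)) ^+ 2 + (2 * p * q) ^+ 2.
  by rewrite normc2E !complex_partsE/=; ring.
have kk (k : R) : - normc a <= k <= normc a -> k ^+ 2 <= normc a ^+ 2.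
  move=> /andP[h1 h2]; have : 0 <= (normc a - k) * (normc a + k).
    by apply: mulr_ge0; lra.
  lra.
have [pq|pq] := eqVneq (p * q) 0; last first.
  exists ((2 * p * q) ^+ 2).
    by rewrite exprn_even_gt0//= -mulrA mulf_neq0// pnatr_eq0.
  by move=> k _; rewrite nE lerDr sqr_ge0.
have [m1|m1] := ltP (p ^+ 2 - q ^+ 2) (1 - normc a ^+ 2).
  exists ((1 - normc a ^+ 2 - (p ^+ 2 - q ^+ 2)) ^+ 2).
    by rewrite exprn_gt0// subr_gt0.
  move=> k /kk k2; rewrite nE -[leLHS]addr0 lerD ?sqr_ge0//.
  by apply: lerXn2r; rewrite ?nnegrE; lra.
have [m2|m2] := ltP 1 (p ^+ 2 - q ^+ 2).
  exists ((p ^+ 2 - q ^+ 2 - 1) ^+ 2).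
    by rewrite exprn_gt0// subr_gt0.
  move=> k _; rewrite nE -[leLHS]addr0 lerD ?sqr_ge0//.
  rewrite -[leRHS]sqrrN; have k2 := sqr_ge0 k.
  by apply: lerXn2r; rewrite ?nnegrE; lra.
exfalso.
have q0 : q = 0.
  have r2 := rho2_lt1 a1.
  move/eqP: pq; rewrite mulf_eq0 => /orP[/eqP p0|/eqP//].
  by move: m1; rewrite p0 expr0n/= => m1; have := sqr_ge0 q; lra.
suff : p +i* q != p%:C by rewrite q0 eqxx.
by apply: h; move: m1 m2; rewrite q0 expr0n/= subr0 => -> ->.
Qed.

Let n l (z : circle R) : R[i] := (1 - kappa a z ^+ 2)%:C - l * l.

Lemma bounded_mfun_gap_inv l (d : R) : 0 < d ->
  (forall z, d <= normc (n l z) ^+ 2) -> bounded_mfun (fun z => (n l z)^-1).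
Proof.
move=> d0 dn.
have mk := measurable_kappa a.
have mr : measurable_fun setT (fun z => Re (n l z)).
  rewrite /n; under eq_fun do rewrite cReD /=.
  by apply: measurable_funD => //; apply: measurable_funB => //; exact: measurable_funX.
have mi : measurable_fun setT (fun z => Im (n l z)).
  rewrite (_ : (fun z => _) = cst (- Im (l * l))); first exact: measurable_cst.
  by apply/funext => z; rewrite /n cImD cImN /= add0r.
have mn : measurable_fun setT (fun z => Re (n l z) ^+ 2 + Im (n l z) ^+ 2).
  by apply: measurable_funD; exact: measurable_funX.
have ReV (w : R[i]) : Re w^-1 = Re w / (Re w ^+ 2 + Im w ^+ 2) by case: w.
have ImV (w : R[i]) : Im w^-1 = - Im w / (Re w ^+ 2 + Im w ^+ 2).
  by case: w => x y /=; rewrite mulNr.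
split.
- by under eq_fun do rewrite ReV; exact: measurable_fun_div.
- by under eq_fun do rewrite ImV; apply: measurable_fun_div => //; exact: measurableT_comp.
- exists d^-1; first by rewrite invr_ge0 ltW.
  move=> z; have := dn z; rewrite !normc2E ReV ImV.
  set p := Re _; set q := Im _ => pq.
  have pq0 : p ^+ 2 + q ^+ 2 != 0 by rewrite gt_eqF// (lt_le_trans d0).
  rewrite [leLHS](_ : _ = (p ^+ 2 + q ^+ 2)^-1).
    by rewrite lef_pV2// posrE (lt_le_trans d0).
  by field.
Qed.

(** The inverse is $u\mapsto(l\,u+(1+\kappa)\,u\circ\varphi)/(1-\kappa^2-l^2)$;
    the denominator commutes with $D$ because it is invariant under $\varphi$. *)
Lemma projdiff_resolvent l :
  (forall x : R, 1 - normc a ^+ 2 <= x ^+ 2 <= 1 -> l != x%:C) ->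
  exists B : {linear H -> H},
    [/\ bounded_operator B, cancel (fun u => D u - l *: u) B &
      cancel B (fun u => D u - l *: u)].
Proof.
move=> /resolvent_gap[d d0 dn].
have {}dn z : d <= normc (n l z) ^+ 2 by apply: dn; exact: kappa_bounds.
have n0 z : n l z != 0.
  apply: contraTneq (dn z) => ->.
  by rewrite normc2E/= expr0n/= addr0 -ltNge.
have nphi z : n l (phi z) = n l z by rewrite /n kappa_mobius sqrrN.
have Bn := bounded_mfun_gap_inv d0 dn.
have Bl := bounded_mfunM (bounded_mfun_cst l) Bn.
have Bk := bounded_mfunM (bounded_mfun_kappa a1 1 1) Bn.
have Bw := bounded_mfun_kappa a1 1 1; have Bc := @bounded_mfun_cst R.
have [B BE] := wcomp_linear_operator a1 Bl Bk.
have nE z : n l z = (1 + 1 * kappa a z)%:C * (1 + 1 * - kappa a z)%:C - l * l.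
  by rewrite /n; apply: complex_ext; rewrite !complex_partsE/=; ring.
exists B; split.
- by have [M h] := wcomp_bounded a1 Bl Bk; exists M => u; rewrite BE.
- move=> u; rewrite BE projdiff_shift wcomp_comp// -[RHS]scale1r -(wcomp_cst a1).
  apply: eq_wcomp => z /=; rewrite ?kappa_mobius; have := n0 z; rewrite nE;
    move: (_%:C) (_%:C) => P Q nz; by field.
- move=> u; rewrite BE projdiff_shift wcomp_comp// -[RHS]scale1r -(wcomp_cst a1).
  apply: eq_wcomp => z /=; rewrite nphi ?kappa_mobius; have := n0 z; rewrite nE;
    move: (_%:C) (_%:C) => P Q nz; by field.
Qed.

(** A bounded left inverse [B] with bound [M] would give, for
    $u=(D+x)g$ with $g$ the indicator function of [E],
    $x^2\mu(E)\le\|u\|^2\le M^2\|(D-x)u\|^2\le M^2e^2\mu(E)$, which fails for the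
    chosen [e]. *)
Lemma projdiff_spectrum (x : R) : 1 - normc a ^+ 2 <= x ^+ 2 <= 1 ->
  operator_spectrum D x%:C.
Proof.
move=> xs [B [[M BM] BK _]].
have s0 : 0 < 1 - normc a ^+ 2 by rewrite subr_gt0; exact: rho2_lt1.
(* This choice makes $M^2e^2$ smaller than $1-|a|^2$, a lower bound of $x^2$. *)
pose e := Num.sqrt (1 - normc a ^+ 2) / (`|M| + 1).
have e0 : 0 < e by rewrite divr_gt0// ?sqrtr_gt0// ltr_wpDl.
have [k1 [k2 [k10 k12 k2a kw]]] := kappa_window xs e0.
pose E := [set z : circle R | k1 < kappa a z < k2].
have mE : measurable E by exact: measurable_kappa_between.
pose I z : R[i] := (\1_E z : R)%:C.
have I2 z : normc (I z) ^+ 2 = \1_E z.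
  by rewrite normc2E /I/= expr0n/= addr0 indicE; case: (_ \in _); rewrite ?expr1n ?expr0n.
have intI : (\int[mu]_z (\1_E z)%:E = mu E)%E by rewrite integral_indic// setIT.
have muE1 : (mu E < +oo)%E by rewrite (le_lt_trans (probability_le1 _ mE))// ltry.
have sqI : square_integrable mu I.
  split; [exact: measurable_indic|exact: measurable_cst|].
  by under eq_integral do rewrite I2; rewrite intI.
pose g := L2class mu I; have gI := L2class_ae sqI.
have Bk := bounded_mfun_kappa a1 1 1; have Bc := @bounded_mfun_cst R.
pose u := wcomp a1 (cst x%:C) (fun z => (1 + 1 * kappa a z)%:C) g.
have [ur ui _] := L2_square_integrable u.
pose v := D u - x%:C *: u; have [vr vi _] := L2_square_integrable v.
have vE : {ae mu, forall z, repr v z = (1 - kappa a z ^+ 2 - x ^+ 2)%:C * I z}.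
  have B1 := bounded_mfunD (bounded_mfunM (Bc (- x%:C)) (Bc x%:C))
    (bounded_mfunM Bk (bounded_mfun_phi a1 Bk)).
  have B2 := bounded_mfunD (bounded_mfunM (Bc (- x%:C)) Bk)
    (bounded_mfunM Bk (bounded_mfun_phi a1 (Bc x%:C))).
  rewrite /v projdiff_shift /u wcomp_comp//.
  apply: filterS2 gI (wcomp_ae a1 g B1 B2) => z gz ->.
  rewrite /wsum gz /= kappa_mobius.
  by apply: complex_ext; rewrite !complex_partsE/=; ring.
have uE : {ae mu, forall z, repr u z = x%:C * I z + (1 + kappa a z)%:C * I (phi z)}.
  apply: filterS3 gI (ae_mobius a1 gI) (wcomp_ae a1 g (Bc x%:C) Bk) => z gz gpz ->.
  by rewrite /wsum gz gpz mul1r.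
have m1 : measurable_fun setT (fun z => (\1_E z)%:E : \bar R).
  by apply/measurable_EFinP; exact: measurable_indic.
have I0 z : (0 <= (\1_E z)%:E :> \bar R)%E by rewrite lee_fin.
have EI (c : R) : 0 <= c ->
    (\int[mu]_z (c%:E * (\1_E z)%:E) = (c * fine (mu E))%:E)%E.
  by move=> c0; rewrite ge0_integralZl// intI EFinM fineK// ge0_fin_numE.
have vle : fine (energy v) <= e ^+ 2 * fine (mu E).
  rewrite -lee_fin fineK ?energy_fin// -EI ?sqr_ge0//.
  apply: ae_ge0_le_integral => //.
  - by move=> z _; rewrite lee_fin sqr_ge0.
  - exact: measurable_normc2.
  - by move=> z _; rewrite mule_ge0// lee_fin sqr_ge0.
  - exact: measurable_funeM.
  apply: filterS vE => z -> _; rewrite -EFinM lee_fin normc2E !complex_partsE/=.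
  rewrite !mul0r subr0 mulr0 addr0 expr0n/= addr0 indicE.
  case: (boolP (z \in E)) => [/set_mem zE|_]; last by rewrite !mulr0 expr0n.
  rewrite !mulr1 -[leLHS]real_normK ?num_real//.
  by apply: lerXn2r; rewrite ?nnegrE ?(ltW e0)//; exact: kw.
have ule : x ^+ 2 * fine (mu E) <= fine (energy u).
  rewrite -lee_fin fineK ?energy_fin// -EI ?sqr_ge0//.
  apply: ae_ge0_le_integral => //.
  - by move=> z _; rewrite mule_ge0// lee_fin sqr_ge0.
  - exact: measurable_funeM.
  - by move=> z _; rewrite lee_fin sqr_ge0.
  - exact: measurable_normc2.
  apply: filterS uE => z -> _; rewrite -EFinM lee_fin normc2E !complex_partsE/=.
  rewrite !mul0r !subr0 !mulr0 !addr0 expr0n/= addr0 !indicE.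
  case: (boolP (z \in E)) => [/set_mem /andP[zE _]|_]; last first.
    by rewrite mulr0 sqr_ge0.
  rewrite (_ : (phi z \in E) = false) ?mulr0 ?addr0 ?mulr1//.
  apply/negbTE/negP => /set_mem /andP[]; rewrite kappa_mobius; lra.
have uBv : L2norm u <= M * L2norm v by rewrite -{1}(BK u).
have muE0 : 0 < fine (mu E).
  by rewrite fine_gt0// muE1 andbT; exact: kappa_between_gt0.
have uv2 : L2norm u ^+ 2 <= M ^+ 2 * L2norm v ^+ 2.
  have u0 : 0 <= L2norm u by exact: sqrtr_ge0.
  by rewrite -exprMn; apply: lerXn2r; rewrite ?nnegrE// (le_trans u0).
have : x ^+ 2 * fine (mu E) <= M ^+ 2 * e ^+ 2 * fine (mu E).
  rewrite (le_trans ule)// -L2norm2 (le_trans uv2)// -mulrA.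
  by rewrite ler_wpM2l ?sqr_ge0// L2norm2.
rewrite ler_pM2r// /e expr_div_n sqr_sqrtr ?(ltW s0)// => xle.
have M1 : 0 < (`|M| + 1) ^+ 2 by rewrite exprn_gt0// ltr_wpDl.
move: xle; rewrite mulrA ler_pdivlMr// -(real_normK (num_real M)).
have := normr_ge0 M; move: (`|M|) => m m0.
move: xs s0 => /andP[]; move: (1 - normc a ^+ 2) (x ^+ 2) => p q h1 h2 h3 h4.
have : 0 < p * (2 * m + 1) by rewrite mulr_gt0//; lra.
have : 0 <= (q - p) * (m + 1) ^+ 2 by rewrite mulr_ge0 ?sqr_ge0// subr_ge0.
lra.
Qed.

Lemma mem_spectrum_set (l : R[i]) :
  ((fun x : R => x%:C) @` (`[-1, - Num.sqrt (1 - normc a ^+ 2)] `|`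
     `[Num.sqrt (1 - normc a ^+ 2), 1])) l <->
  exists2 x : R, 1 - normc a ^+ 2 <= x ^+ 2 <= 1 & l = x%:C.
Proof.
have s0 : 0 <= 1 - normc a ^+ 2 by rewrite subr_ge0 ltW//; exact: rho2_lt1.
have s2 := sqr_sqrtr s0; have s00 := sqrtr_ge0 (1 - normc a ^+ 2).
set s := Num.sqrt _ in s2 s00 *; split.
  move=> [x xI <-]; exists x => //; rewrite -s2.
  have : s <= `|x| <= 1.
    case: xI => /=; rewrite in_itv/= => /andP[h1 h2].
      by rewrite ler0_norm; lra.
    by rewrite ger0_norm; lra.
  move=> /andP[h1 h2]; rewrite -(real_normK (num_real x)).
  by rewrite -[X in _ && (_ <= X)](expr1n _ 2) !ler_pXn2r ?nnegrE// h1.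
move=> [x]; rewrite -s2 -(real_normK (num_real x)).
rewrite -[X in _ && (_ <= X)](expr1n _ 2) !ler_pXn2r ?nnegrE// => /andP[h1 h2] ->.
exists x => //; have [x0|x0] := leP 0 x.
  by right; rewrite /= in_itv/=; move: h1 h2; rewrite ger0_norm// => -> ->.
by left; rewrite /= in_itv/=; move: h1 h2; rewrite ltr0_norm//; lra.
Qed.

End spectrum.

Theorem theorem6p3 (R : realType) (a : R[i]) (a1 : `|a| < 1) (a0 : a != 0) :
  let C := Cmobius a1 in
  let N1 := nullspace (C \- id) in
  let N2 := nullspace (C \+ id) in
  let D := orthoproj N1 \- orthoproj N2 in
  let s : R := Num.sqrt (1 - ComplexField.Normc.normc a ^+ 2) in
  [/\ operator_spectrum D = (fun x : R => x%:C) @` (`[-1, - s] `|` `[s, 1]),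
      forall l : R[i], ~ operator_eigenvalue D l,
      N1 `&` orthocomplement N2 = [set 0] &
      [set 0] = orthocomplement N1 `&` N2].
Proof.
move=> C N1 N2 D s; rewrite /D /N1 /N2 /C orthoproj_sub; split.
- apply/seteqP; split => l; last first.
    by move=> /(mem_spectrum_set a1)[x xs ->]; exact: projdiff_spectrum.
  move=> sl; apply: contrapT => nl; apply: sl; apply: projdiff_resolvent => //.
  move=> x xs; apply/eqP => lx; apply: nl; apply/(mem_spectrum_set a1).
  by exists x.
- exact: projdiff_no_eigenvalue.
- rewrite nullspace_fixed nullspace_negated.
  by apply: symspace_meets_orthocomplement; rewrite ?mulr1.
- rewrite nullspace_fixed nullspace_negated setIC; apply/esym.
  by apply: symspace_meets_orthocomplement; rewrite ?mulrNN ?mulr1 ?opprK.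
Qed.
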